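(* Let $\mathbb{K}\in\{\mathbb{R},\mathbb{C}\}$ and let $\Sigma$ be a descriptor system over $\mathbb{K}$, with $m$ inputs and $m$ outputs, which is behaviorally controllable and behaviorally observable and whose transfer function $\mathcal{T}$ is positive real. Write $\mathcal{T}(s)=M_1s+\mathcal{T}_p(s)$ with $M_1=M_1^H\ge 0$ and $\mathcal{T}_p$ proper, put $M_0=\lim_{s\to\infty}\mathcal{T}_p(s)$, and let $\mathcal{T}_p(s)=C_p(sE_p-A_p)^{-1}B_p+M_0$ be a minimal realization of $\mathcal{T}_p$, with $E_p$ invertible. Then there exists an invertible matrix $Q_p$ with $Q_p^HE_p\ge 0$ for which $(E_p,A_p,B_p,C_p,M_0)$ fulfills (pH) with $Q=Q_p$, and a port-Hamiltonian realization of $\mathcal{T}$ is obtained via $$E_{pH}:=\begin{bmatrix} E_p & 0 & 0 \\ 0 & M_1 & 0 \\ 0 & 0 & 0 \end{bmatrix},\quad A_{pH}:=\begin{bmatrix} A_p & 0 & 0 \\ 0 & 0 & -I_m \\ 0 & I_m & 0 \end{bmatrix},\quad B_{pH}:=\begin{bmatrix} B_p \\ 0 \\ I_m \end{bmatrix},$$ $$C_{pH}:=\begin{bmatrix} C_p & 0 & I_m \end{bmatrix},\quad D_{pH}:=M_0,\quad Q:=\begin{bmatrix} Q_p & 0 \\ 0 & I_{2m} \end{bmatrix},$$ that is, $(E_{pH},A_{pH},B_{pH},C_{pH},D_{pH})$ has transfer function $\mathcal{T}$ and fulfills (pH) with this $Q$.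
   Context: A descriptor system $(E,A,B,C,D)$ over $\mathbb{K}$ is given by $E,A\in\mathbb{K}^{n\times n}$, $B\in\mathbb{K}^{n\times m}$, $C\in\mathbb{K}^{m\times n}$, $D\in\mathbb{K}^{m\times m}$, where $\lambda E-A$ is invertible for some $\lambda\in\mathbb{C}$, and stands for $\tfrac{d}{dt}Ex=Ax+Bu$, $y=Cx+Du$. Its transfer function is $C(sE-A)^{-1}B+D$, and the system is called a realization of this function; the realization is minimal if the number of states $n$ is minimal among all realizations. The system is behaviorally controllable if $\operatorname{rk}[\lambda E-A,\,B]=n$ for all $\lambda\in\mathbb{C}$, and behaviorally observable if $\operatorname{rk}\begin{bmatrix}\lambda E-A\\ C\end{bmatrix}=n$ for all $\lambda\in\mathbb{C}$. $M^H$ is the conjugate transpose; $M\ge 0$ means Hermitian positive semidefinite. A rational matrix function $\mathcal{T}$ is positive real if it has no poles in $\{s\in\mathbb{C}:\operatorname{Re}s>0\}$ and $\mathcal{T}(s)+\mathcal{T}(s)^H\ge 0$ for all $s\in\mathbb{C}$ with $\operatorname{Re}s>0$; it is proper if $\lim_{s\to\infty}\mathcal{T}(s)$ exists. Every positive real transfer function has a decomposition $M_1s+\mathcal{T}_p(s)$ of the stated form. A system $(E,A,B,C,D)$ fulfills (pH) (is port-Hamiltonian) with $Q\in\mathbb{K}^{n\times n}$ if there exist $J,R\in\mathbb{K}^{n\times n}$, $G,P\in\mathbb{K}^{n\times m}$, $S,N\in\mathbb{K}^{m\times m}$ with $$\begin{bmatrix} A & B \\ C & D \end{bmatrix}=\begin{bmatrix}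 (J-R)Q & G-P \\ (G+P)^HQ & S+N \end{bmatrix},\quad Q^HE=E^HQ\ge 0,$$ $$\Gamma:=\begin{bmatrix} J & G \\ -G^H & N \end{bmatrix}=-\Gamma^H,\quad W:=\begin{bmatrix} Q^HRQ & Q^HP \\ P^HQ & S \end{bmatrix}=W^H\ge 0.$$ *)

(* Defs.v *)
From HB Require Import structures.
From mathcomp Require Import all_boot all_order all_algebra.
From mathcomp Require Import complex.
From mathcomp Require Import reals.

Set Implicit Arguments.
Unset Strict Implicit.
Unset Printing Implicit Defensive.

Import Order.TTheory GRing.Theory Num.Theory.
Local Open Scope ring_scope.
Local Open Scope sesquilinear_scope.

(* Everything lives over an algebraically closed numeric field C, used with
   C := R[i] for R : realType.  The choice of base field, the reals or all of
   C, is the choice of the set in which matrix entries are allowed to lie. *)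
Variant base_field := RealBase | ComplexBase.

Definition in_base (C : numClosedFieldType) (K : base_field) : {pred C} :=
  fun x => if K is RealBase then x \is Num.real else true.

Definition mx_over (C : numClosedFieldType) (K : base_field) (m n : nat)
  (M : 'M[C]_(m, n)) : Prop := M \is a mxOver (@in_base C K).

Definition psdmx (C : numClosedFieldType) (n : nat) (M : 'M[C]_n) : Prop :=
  M = M ^t* /\ forall x : 'cV[C]_n, 0 <= (x ^t* *m M *m x) 0 0.

Section RationalMatrices.
Variable C : numClosedFieldType.

Definition ratfun := {fraction {poly C}}.

Definition ratX : ratfun := tofrac 'X.
Definition ratC (c : C) : ratfun := tofrac c%:P.

(* [f] has no pole at [s] and takes the value [v] there; [p] and [q] need not
   be coprime, but the value does not depend on their choice. *)
Definition has_value (f : ratfun) (s v : C) : Prop :=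
  exists p q : {poly C},
    [/\ q.[s] != 0, f = tofrac p / tofrac q & v = p.[s] / q.[s]].

Definition pole (f : ratfun) (s : C) : Prop := ~ exists v, has_value f s v.

Definition has_mxvalue (m n : nat) (T : 'M[ratfun]_(m, n)) (s : C)
  (V : 'M[C]_(m, n)) : Prop := forall i j, has_value (T i j) s (V i j).

Definition positive_real (m : nat) (T : 'M[ratfun]_m) : Prop :=
  (forall s : C, 0 < 'Re s -> forall i j, ~ pole (T i j) s) /\
  (forall (s : C) (V : 'M[C]_m),
      0 < 'Re s -> has_mxvalue T s V -> psdmx (V + V ^t*)).

(* The limit as [`|s|] tends to infinity in the complex plane, entrywise.  The
   bounds [e] and [r] are elements of C, and being positive makes them real. *)
Definition lim_infty (m n : nat) (T : 'M[ratfun]_(m, n)) (L : 'M[C]_(m, n)) :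
    Prop :=
  forall e : C, 0 < e -> exists2 r : C, 0 < r &
    forall s : C, r < `|s| -> exists2 V : 'M[C]_(m, n),
      has_mxvalue T s V & forall i j, `|V i j - L i j| < e.

Definition proper_ratmx (m n : nat) (T : 'M[ratfun]_(m, n)) : Prop :=
  exists L, lim_infty T L.

End RationalMatrices.

Record system (C : numClosedFieldType) (n m : nat) := System {
  sysE : 'M[C]_n;
  sysA : 'M[C]_n;
  sysB : 'M[C]_(n, m);
  sysC : 'M[C]_(m, n);
  sysD : 'M[C]_m
}.

Section Systems.
Variable C : numClosedFieldType.

Definition descriptor_system (K : base_field) (n m : nat)
    (S : system C n m) : Prop :=
  [/\ mx_over K (sysE S), mx_over K (sysA S), mx_over K (sysB S),
      mx_over K (sysC S) & mx_over K (sysD S)] /\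
  exists l : C, l *: sysE S - sysA S \in unitmx.

Definition transfer (n m : nat) (S : system C n m) : 'M[ratfun C]_m :=
  map_mx (@ratC C) (sysC S) *m
  invmx (ratX C *: map_mx (@ratC C) (sysE S) - map_mx (@ratC C) (sysA S)) *m
  map_mx (@ratC C) (sysB S) + map_mx (@ratC C) (sysD S).

Definition realization (K : base_field) (n m : nat) (S : system C n m)
    (T : 'M[ratfun C]_m) : Prop :=
  descriptor_system K S /\ transfer S = T.

Definition minimal_realization (K : base_field) (n m : nat)
    (S : system C n m) (T : 'M[ratfun C]_m) : Prop :=
  realization K S T /\
  forall (n' : nat) (S' : system C n' m), realization K S' T -> (n <= n')%N.

Definition behaviorally_controllable (n m : nat) (S : system C n m) : Prop :=
  forall l : C, \rank (row_mx (l *: sysE S - sysA S) (sysB S)) = n.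

Definition behaviorally_observable (n m : nat) (S : system C n m) : Prop :=
  forall l : C, \rank (col_mx (l *: sysE S - sysA S) (sysC S)) = n.

Definition port_Hamiltonian (K : base_field) (n m : nat)
    (S : system C n m) (Q : 'M[C]_n) : Prop :=
  mx_over K Q /\
  exists (J R : 'M[C]_n) (G P : 'M[C]_(n, m)) (S0 N : 'M[C]_m),
    [/\ mx_over K J, mx_over K R, mx_over K G & mx_over K P] /\
    [/\ mx_over K S0 & mx_over K N] /\
    [/\ block_mx (sysA S) (sysB S) (sysC S) (sysD S) =
          block_mx ((J - R) *m Q) (G - P) ((G + P) ^t* *m Q) (S0 + N),
        Q ^t* *m sysE S = (sysE S) ^t* *m Q /\ psdmx (Q ^t* *m sysE S),
        (let Gamma := block_mx J G (- G ^t*) N in Gamma = - Gamma ^t*) &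
        (let W := block_mx (Q ^t* *m R *m Q) (Q ^t* *m P)
                           (P ^t* *m Q) S0 in
         W = W ^t* /\ psdmx W)].

(* Appends to a realization of the proper part a block of 2 * m states, which
   contributes the polynomial part M1 * s to the transfer function. *)
Definition extended_system (n m : nat) (S : system C n m) (M1 : 'M[C]_m) :
    system C (n + (m + m)) m :=
  System
    (block_mx (sysE S) 0 0 (block_mx M1 0 0 0))
    (block_mx (sysA S) 0 0 (block_mx 0 (- 1%:M) 1%:M 0))
    (col_mx (sysB S) (col_mx 0 1%:M))
    (row_mx (sysC S) (row_mx 0 1%:M))
    (sysD S).

End Systems.

(* Main.v *)
Require Import Defs.
From HB Require Import structures.
From mathcomp Require Import all_boot all_order all_algebra.
From mathcomp Require Import complex ring.
From mathcomp Require Import boolp classical_sets filter reals topology normedtype.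

Set Implicit Arguments.
Unset Strict Implicit.
Unset Printing Implicit Defensive.

Import Order.TTheory GRing.Theory Num.Theory.
Local Open Scope ring_scope.
Local Open Scope sesquilinear_scope.

(* The heart of the matter is the positive real (Kalman-Yakubovich-Popov) lemma
   for the minimal realization (A, B, L, M0) of the proper part with E = I: a
   Hermitian X >= 0 with

     kyp_mx X = [ -(A^H X + X A)  L^H - X B ;  L - B^H X  M0 + M0^H ] >= 0.

   For e > 0 one first solves the strict problem for A - e, with M0 + M0^H
   replaced by M0 + M0^H + 2 e M1 + e.  On the line Re s = e the term 2 e M1
   compensates the polynomial part of the transfer function, so positive
   realness of T itself suffices and T_p need not be shown positive real.
   Solvability is a separation argument: otherwise a nonzero W >= 0 orthogonal
   to all matrices linear in X would violate the inequality, but such a W is a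
   sum of rank-one matrices w w^H with w = (x, u), (A - e) x + B u = i om x (or
   x = 0), on which the inequality is the frequency condition.  Lyapunov's
   theorem gives X >= 0, and controllability bounds the solutions as e tends
   to 0.  Observability makes X invertible; over the reals X is replaced by its
   real part.  Then Q_p = E_p^-H X, and the extension by 2 m states leaves the
   inequality unchanged up to a congruence. *)

(** * Values of rational matrix functions *)

(** The shift by [e] is there because positive realness speaks only of the open right half-plane:
    [A] may have imaginary eigenvalues, whereas the frequency condition and Lyapunov's theorem are
    used on the imaginary axis itself. After the shift the axis stands for the line [Re s = e],
    which is free of poles. The extra [e] in the corner makes the frequency condition strict, as the
    separation argument requires.

    That [A = E_p^-1 A_p] has no eigenvalue with positive real part must itself be derived:
    minimality excludes cancellations, so every eigenvalue of [A] is a pole of [T_p]. Since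
    minimality compares only realizations with entries in K, a complex vector witnessing a defect
    has to be replaced by one over K before the state space can be cut down. *)

Section Values.
Variable C : numClosedFieldType.
Implicit Types (f g : ratfun C) (s v w : C).

HB.instance Definition _ :=
  GRing.RMorphism.copy (@ratC C) (@FracField.tofrac {poly C} \o polyC).

Lemma tofrac_neq0 (q : {poly C}) s : q.[s] != 0 -> tofrac q != 0.
Proof.
by rewrite tofrac_eq0; apply: contraNneq => ->; rewrite horner0.
Qed.

Lemma has_value_tofrac (p : {poly C}) s : has_value (tofrac p) s p.[s].
Proof.
by exists p, 1; rewrite hornerC oner_eq0 tofrac1 !divr1.
Qed.

Lemma has_value_ratC c s : has_value (ratC c) s c.
Proof. by have := has_value_tofrac c%:P s; rewrite hornerC. Qed.

Lemma has_value_ratX s : has_value (ratX C) s s.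
Proof. by have := has_value_tofrac 'X s; rewrite hornerX. Qed.

Lemma has_valueD f g s v w :
  has_value f s v -> has_value g s w -> has_value (f + g) s (v + w).
Proof.
move=> [p [q [qs -> ->]]] [p' [q' [qs' -> ->]]].
exists (p * q' + p' * q), (q * q'); split.
- by rewrite hornerM mulf_neq0.
- rewrite tofracD !tofracM; apply: addf_div.
    exact: tofrac_neq0 qs.
  exact: tofrac_neq0 qs'.
- by rewrite hornerD !hornerM addf_div.
Qed.

Lemma has_valueM f g s v w :
  has_value f s v -> has_value g s w -> has_value (f * g) s (v * w).
Proof.
move=> [p [q [qs -> ->]]] [p' [q' [qs' -> ->]]].
exists (p * p'), (q * q'); split.
- by rewrite hornerM mulf_neq0.
- by rewrite !tofracM; exact: mulf_div.
- by rewrite !hornerM mulf_div.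
Qed.

Lemma has_valueN f s v : has_value f s v -> has_value (- f) s (- v).
Proof.
by move=> /(has_valueM (has_value_ratC (-1) s)); rewrite mulN1r /ratC polyCN
  tofracN tofrac1 mulN1r.
Qed.

Lemma has_value_uniq f s v w : has_value f s v -> has_value f s w -> v = w.
Proof.
move=> [p [q [qs -> ->]]] [p' [q' [qs' + ->]]] => /eqP.
rewrite (eqr_div _ _ (tofrac_neq0 qs) (tofrac_neq0 qs')) -!tofracM tofrac_eq.
move=> /eqP /(congr1 (fun p => p.[s])); rewrite !hornerM => h.
by apply/eqP; rewrite eqr_div // h.
Qed.

Lemma has_value_sum (I : finType) (f : I -> ratfun C) s (v : I -> C) :
  (forall i, has_value (f i) s (v i)) ->
  has_value (\sum_i f i) s (\sum_i v i).
Proof.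
move=> h; elim: (index_enum I) => [|i r IH].
  rewrite !big_nil; have := has_value_ratC 0 s.
  by rewrite /ratC polyC0 tofrac0.
by rewrite !big_cons; exact: has_valueD.
Qed.

Lemma has_mxvalue_ratC m n (M : 'M[C]_(m, n)) s :
  has_mxvalue (map_mx (@ratC C) M) s M.
Proof. by move=> i j; rewrite mxE; exact: has_value_ratC. Qed.

Lemma has_mxvalueD m n (F G : 'M[ratfun C]_(m, n)) s V W :
  has_mxvalue F s V -> has_mxvalue G s W -> has_mxvalue (F + G) s (V + W).
Proof. by move=> hF hG i j; rewrite !mxE; exact: has_valueD. Qed.

Lemma has_mxvalueN m n (F : 'M[ratfun C]_(m, n)) s V :
  has_mxvalue F s V -> has_mxvalue (- F) s (- V).
Proof. by move=> hF i j; rewrite !mxE; exact: has_valueN. Qed.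

Lemma has_mxvalueZ m n f (F : 'M[ratfun C]_(m, n)) s v V :
  has_value f s v -> has_mxvalue F s V -> has_mxvalue (f *: F) s (v *: V).
Proof. by move=> hf hF i j; rewrite !mxE; exact: has_valueM. Qed.

Lemma has_mxvalueM m n p (F : 'M[ratfun C]_(m, n)) (G : 'M_(n, p)) s V W :
  has_mxvalue F s V -> has_mxvalue G s W -> has_mxvalue (F *m G) s (V *m W).
Proof.
move=> hF hG i j; rewrite !mxE; apply: has_value_sum => k.
exact: has_valueM.
Qed.

Lemma has_mxvalue_uniq m n (F : 'M[ratfun C]_(m, n)) s V W :
  has_mxvalue F s V -> has_mxvalue F s W -> V = W.
Proof.
by move=> hV hW; apply/matrixP => i j; exact: has_value_uniq (hV i j) (hW i j).
Qed.

Definition ratpencil n (E A : 'M[C]_n) : 'M[ratfun C]_n :=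
  ratX C *: map_mx (@ratC C) E - map_mx (@ratC C) A.

Lemma has_mxvalue_pencil n (E A : 'M[C]_n) s :
  has_mxvalue (ratpencil E A) s (s *: E - A).
Proof.
apply: has_mxvalueD; last exact/has_mxvalueN/has_mxvalue_ratC.
by apply: has_mxvalueZ; [exact: has_value_ratX | exact: has_mxvalue_ratC].
Qed.

Definition polypencil n (E A : 'M[C]_n) : 'M[{poly C}]_n :=
  'X *: map_mx polyC E - map_mx polyC A.

Lemma ratpencilE n (E A : 'M[C]_n) :
  ratpencil E A = map_mx (@FracField.tofrac _) (polypencil E A).
Proof.
by apply/matrixP => i j; rewrite !mxE -tofracM -tofracB.
Qed.

Lemma horner_polypencil n (E A : 'M[C]_n) s :
  map_mx (horner_eval s) (polypencil E A) = s *: E - A.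
Proof. by apply/matrixP => i j; rewrite !mxE /horner_eval !hornerE. Qed.

Lemma horner_det_polypencil n (E A : 'M[C]_n) s :
  (\det (polypencil E A)).[s] = \det (s *: E - A).
Proof. by rewrite -horner_polypencil det_map_mx. Qed.

Lemma det_ratpencil n (E A : 'M[C]_n) :
  \det (ratpencil E A) = tofrac (\det (polypencil E A)).
Proof. by rewrite ratpencilE det_map_mx. Qed.

Lemma ratpencil_unit n (E A : 'M[C]_n) s :
  s *: E - A \in unitmx -> ratpencil E A \in unitmx.
Proof.
rewrite !unitmxE !unitfE -horner_det_polypencil det_ratpencil.
exact: tofrac_neq0.
Qed.

Lemma ratpencil_mulV n (E A : 'M[C]_n) : ratpencil E A \in unitmx ->
  tofrac (\det (polypencil E A)) *: invmx (ratpencil E A) =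
  map_mx (@FracField.tofrac _) (\adj (polypencil E A)).
Proof.
move=> u; rewrite /invmx u scalerA det_ratpencil mulfV ?scale1r.
  by rewrite ratpencilE map_mx_adj.
by move: u; rewrite unitmxE unitfE det_ratpencil.
Qed.

(** Cramer's rule supplies the denominator [\det (polypencil E A)], nonzero at [s]. *)
Lemma has_mxvalue_inv n (E A : 'M[C]_n) s : s *: E - A \in unitmx ->
  has_mxvalue (invmx (ratpencil E A)) s (invmx (s *: E - A)).
Proof.
move=> u; have ru := ratpencil_unit u.
have d0 : (\det (polypencil E A)).[s] != 0.
  by rewrite horner_det_polypencil -unitfE -unitmxE.
rewrite /invmx u ru det_ratpencil => i j.
rewrite mxE [X in has_value _ _ X]mxE.
exists ((\adj (polypencil E A)) i j), (\det (polypencil E A)); split=> //.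
  by rewrite mulrC ratpencilE -map_mx_adj mxE.
rewrite mulrC horner_det_polypencil; congr (_ / _).
by rewrite -horner_polypencil -map_mx_adj mxE.
Qed.

Lemma has_mxvalue_transfer n m (S : system C n m) s :
  s *: sysE S - sysA S \in unitmx ->
  has_mxvalue (transfer S) s
    (sysC S *m invmx (s *: sysE S - sysA S) *m sysB S + sysD S).
Proof.
move=> u; apply: has_mxvalueD; last exact: has_mxvalue_ratC.
apply: has_mxvalueM; last exact: has_mxvalue_ratC.
by apply: has_mxvalueM; [exact: has_mxvalue_ratC | exact: has_mxvalue_inv].
Qed.

(* A regular pencil is singular at finitely many points, so some natural number
   outside a given finite set works. *)
Lemma pencil_unit_nat n (E A : 'M[C]_n) n' (E' A' : 'M[C]_n') :
  (exists l, l *: E - A \in unitmx) -> (exists l, l *: E' - A' \in unitmx) ->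
  exists k : nat, [/\ (0 < k)%N, k%:R *: E - A \in unitmx
                   & k%:R *: E' - A' \in unitmx].
Proof.
move=> [l hl] [l' hl'].
pose p := \det (polypencil E A) * \det (polypencil E' A').
have p0 : p != 0.
  apply: mulf_neq0; apply/eqP => /(congr1 (fun p => p.[_])) h.
    by move: (h l); rewrite horner_det_polypencil horner0 => /eqP;
      apply/negP; rewrite -unitfE -unitmxE.
  by move: (h l'); rewrite horner_det_polypencil horner0 => /eqP;
    apply/negP; rewrite -unitfE -unitmxE.
pose ks := [seq (k%:R : C) | k <- iota 1 (size p)].
have uks : uniq ks.
  by rewrite map_inj_uniq ?iota_uniq // => i j /eqP; rewrite eqr_nat => /eqP.
have : ~~ all (root p) ks.
  by apply/negP => /(max_poly_roots p0)/(_ uks);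
    rewrite size_map size_iota ltnn.
rewrite all_map -has_predC => /hasP[k]; rewrite mem_iota => /andP[k0 _] /=.
rewrite rootE hornerM !horner_det_polypencil mulf_eq0 negb_or => /andP[h h'].
by exists k; rewrite !unitmxE !unitfE.
Qed.

End Values.

(** * Minimal realizations *)

Definition kalman_observable (F : fieldType) n m (A : 'M[F]_n) (L : 'M[F]_(m, n)) :=
  forall x : 'cV[F]_n, (forall j, L *m A ^+ j *m x = 0) -> x = 0.

Definition kalman_controllable (F : fieldType) n m (A : 'M[F]_n) (B : 'M[F]_(n, m)) :=
  forall y : 'rV[F]_n, (forall j, y *m A ^+ j *m B = 0) -> y = 0.

Section Reduction.
Variable F : fieldType.

(** By Cayley-Hamilton, [A ^+ i] is a polynomial in [A] of degree below [n]. This lets the single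
    matrix [K] of [unobservable_reduction] encode infinitely many conditions. *)
Lemma krylov_kernel n (A : 'M[F]_n) (x : 'cV[F]_n) m (Y : 'M[F]_(m, n)) :
  (forall i, (i < n)%N -> Y *m A ^+ i *m x = 0) ->
  forall i, Y *m A ^+ i *m x = 0.
Proof.
case: n A x Y => [|n] A x Y h i; first by rewrite [x]flatmx0 mulmx0.
have -> : A ^+ i = horner_mx A ('X^i %% char_poly A).
  rewrite -{1}(horner_mx_X A) -rmorphXn /=.
  rewrite [in LHS](divp_eq 'X^i (char_poly A)) rmorphD rmorphM /=.
  by rewrite Cayley_Hamilton mulr0 add0r.
set p := _ %% _.
have sp : (size p <= n.+1)%N.
  have := ltn_modp 'X^i (char_poly A).
  by rewrite monic_neq0 ?char_poly_monic // size_char_poly ltnS.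
rewrite -[p]coefK poly_def rmorph_sum /= mulmx_sumr mulmx_suml big1 // => k _.
rewrite linearZ /= rmorphXn /= horner_mx_X -scalemxAr -scalemxAl h ?scaler0 //.
exact: leq_trans sp.
Qed.

(** The rows of [T] form a basis of the annihilator of the Krylov vectors [A ^+ i *m x]. This row
    space is stable under [A] and contains the rows of [L], so both factor through [T]; it is proper
    because [x], the vector for [i = 0], is nonzero. *)
Lemma unobservable_reduction n m (A : 'M[F]_n) (L : 'M[F]_(m, n)) (x : 'cV[F]_n) :
  x != 0 -> (forall j, L *m A ^+ j *m x = 0) ->
  exists n' (T : 'M[F]_(n', n)) (A2 : 'M[F]_n') (L2 : 'M[F]_(m, n')),
    [/\ (n' < n)%N, T *m A = A2 *m T & L = L2 *m T].
Proof.
move=> x0 hx.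
pose K : 'M[F]_n := (\matrix_(i < n) (A ^+ i *m x)^T)^T.
have KP p (Y : 'M[F]_(p, n)) :
    reflect (forall i, Y *m A ^+ i *m x = 0) (Y <= kermx K)%MS.
  apply: (iffP sub_kermxP) => h.
    apply: krylov_kernel => i hi.
    move/(congr1 (col (Ordinal hi))): h.
    by rewrite colE -mulmxA -colE -tr_row rowK trmxK mulmxA => ->; rewrite col0.
  apply/matrixP => a b.
  have -> : (Y *m K) a b = (Y *m (A ^+ b *m x)) a 0.
    by rewrite !mxE; apply: eq_bigr => j _; rewrite !mxE.
  by rewrite mulmxA h !mxE.
pose T := row_base (kermx K).
have TK : (T <= kermx K)%MS by rewrite eq_row_base.
have /submxP[A2 hA2] : (T *m A <= T)%MS.
  rewrite eq_row_base; apply/KP => i.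
  rewrite -[T *m A *m _]mulmxA -[A *m A ^+ i]/(A * A ^+ i) -exprS.
  by move/KP: TK => ->.
have /submxP[L2 hL2] : (L <= T)%MS by rewrite eq_row_base; apply/KP.
exists (\rank (kermx K)), T, A2, L2; split=> //.
have n0 : (0 < n)%N.
  by case: n A L x x0 {hx K KP T TK A2 hA2 L2 hL2} => // A L x; rewrite [x]flatmx0 eqxx.
rewrite mxrank_ker -subn_gt0 subKn ?rank_leq_row // lt0n mxrank_eq0.
apply: contraNneq x0 => /(congr1 (col (Ordinal n0))) /eqP.
by rewrite -tr_row rowK trmxK expr0 mul1mx col0.
Qed.

End Reduction.

Section Minimality.

(** The hypotheses give [T' (s E - A) = (s E' - A') T], hence [(s E' - A')^-1 T' = T (s E - A)^-1].
    Having two intertwiners lets one statement cover both state reductions and the passage from [E]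
    to the identity. *)
Lemma transfer_intertwine (C : numClosedFieldType) n n' m (S : system C n m)
    (S' : system C n' m) (T T' : 'M[C]_(n', n)) :
  (exists l, l *: sysE S - sysA S \in unitmx) ->
  (exists l, l *: sysE S' - sysA S' \in unitmx) ->
  T' *m sysE S = sysE S' *m T -> T' *m sysA S = sysA S' *m T ->
  sysB S' = T' *m sysB S -> sysC S = sysC S' *m T -> sysD S' = sysD S ->
  transfer S' = transfer S.
Proof.
move=> [l /ratpencil_unit u] [l' /ratpencil_unit u'] hE hA hB hC hD.
rewrite /transfer hB hC hD; congr (_ + _).
rewrite -!/(ratpencil _ _) !map_mxM.
set P' := ratpencil _ _; set P := ratpencil _ _; rewrite -/P -/P' in u u'.
have h : map_mx (@ratC C) T' *m P = P' *m map_mx (@ratC C) T.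
  rewrite mulmxBr mulmxBl -scalemxAr -scalemxAl -!map_mxM.
  by rewrite hE hA.
have {}h : invmx P' *m map_mx (@ratC C) T' = map_mx (@ratC C) T *m invmx P.
  by rewrite -[LHS](mulmxK u) -[_ *m _ *m P]mulmxA h mulKmx.
by rewrite -!mulmxA [invmx P' *m _]mulmxA h !mulmxA.
Qed.

Lemma resolvent_regular (C : numClosedFieldType) n (A : 'M[C]_n) :
  exists l, l *: 1%:M - A \in unitmx.
Proof.
have p0 : char_poly A != 0 by rewrite monic_neq0 ?char_poly_monic.
have [l hl] := closed_nonrootP (char_poly A) p0.
exists l; rewrite unitmxE unitfE; apply: contra hl => /eqP h.
rewrite -horner_det_polypencil in h.
rewrite rootE /char_poly /char_poly_mx -[X in _ == X]h.
by rewrite /polypencil map_scalar_mx scale_scalar_mx mulr1.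
Qed.

(** The image of [F] under [f] is the set of entries allowed by [K]. Over the reals [x'] is the real
    or the imaginary part of [x], chosen before [M], so that one [x'] serves infinitely many
    equations at once. *)
Lemma base_field_model (R : realType) (K : base_field) :
  exists (F : fieldType) (f : {rmorphism F -> R[i]}),
    (forall m n (M : 'M_(m, n)),
        mx_over K M <-> exists M', M = map_mx f M') /\
    (forall n (x : 'cV[R[i]]_n), x != 0 -> exists2 x' : 'cV[F]_n, x' != 0 &
       forall p (M : 'M_(p, n)), map_mx f M *m x = 0 -> M *m x' = 0).
Proof.
case: K; last first.
  exists R[i], idfun; split=> [m n M|n x x0].
    split=> _; last by apply/mxOverP.
    by exists M; rewrite map_mx_id.
  by exists x => // p M; rewrite map_mx_id.
exists R, (real_complex R); split=> [m n M|n x x0].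
  split=> [/mxOverP h|[M' ->]].
    exists (map_mx (@complex.Re R) M); apply/matrixP => i j.
    rewrite !mxE /= RRe_real //; exact: h.
  by apply/mxOverP => i j; rewrite mxE /in_base unfold_in /= complex_real.
have hre p (M : 'M_(p, n)) : map_mx (real_complex R) M *m x = 0 ->
    M *m map_mx (@complex.Re R) x = 0 /\ M *m map_mx (@complex.Im R) x = 0.
  move=> /matrixP h; split; apply/matrixP => i j; have := h i j;
    rewrite !mxE => /eqP; rewrite eq_complex => /andP[/eqP hr /eqP hi].
    rewrite -[RHS]hr raddf_sum /=; apply: eq_bigr => k _.
    by rewrite !mxE; case: (x k j) => a b /=; rewrite mul0r subr0.
  rewrite -[RHS]hi raddf_sum /=; apply: eq_bigr => k _.
  by rewrite !mxE; case: (x k j) => a b /=; rewrite mul0r addr0.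
have [re0|re0] := eqVneq (map_mx (@complex.Re R) x) 0; last first.
  by exists (map_mx (@complex.Re R) x) => // p M /hre[].
exists (map_mx (@complex.Im R) x) => [|p M /hre[] //].
apply: contra_neq x0 => im0; apply/matrixP => i j.
have := congr1 (fun M : 'M_(n, 1) => M i j) re0.
have := congr1 (fun M : 'M_(n, 1) => M i j) im0.
by rewrite !mxE; case: (x i j) => a b /= -> ->.
Qed.

Lemma map_mxXn (F F' : fieldType) (f : {rmorphism F -> F'}) n (A : 'M_n) j :
  map_mx f (A ^+ j) = map_mx f A ^+ j.
Proof.
elim: j => [|j IH]; first by rewrite !expr0 map_mx1.
by rewrite !exprS map_mxM IH.
Qed.

Variable R : realType.
Variables (K : base_field) (n m : nat) (E A : 'M[R[i]]_n) (B : 'M[R[i]]_(n, m)).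
Variables (L : 'M[R[i]]_(m, n)) (D : 'M[R[i]]_m) (T : 'M[ratfun R[i]]_m).
Hypothesis hmin : minimal_realization K (System E A B L D) T.
Hypothesis uE : E \in unitmx.

(** An unobservable vector, transferred to [F], would yield a realization over [K] with [k < n]
    states. *)
Lemma minimal_observable : kalman_observable (invmx E *m A) L.
Proof.
move=> x hx; apply/eqP/negPn/negP => x0.
have [[[[/= oE oA oB oL oD] reg] trT] mn] := hmin.
have [F [f [fP fx]]] := base_field_model R K.
have [E' eE] := (fP _ _ _).1 oE; have [A' eA] := (fP _ _ _).1 oA.
have [B' eB] := (fP _ _ _).1 oB; have [L' eL] := (fP _ _ _).1 oL.
have [x' x'0 hx'] := fx _ _ x0.
have [|k [V [A2 [L2 [kn hA hL]]]]] :=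
    @unobservable_reduction F n m (invmx E' *m A') L' x' x'0.
  by move=> j; apply: hx'; rewrite map_mxM map_mxXn map_mxM map_invmx -eE -eA -eL hx.
pose S' := System 1%:M (map_mx f A2) (map_mx f (V *m invmx E' *m B'))
             (map_mx f L2) D.
suff : (n <= k)%N by rewrite leqNgt kn.
apply: (mn _ S'); split.
  split; last exact: resolvent_regular.
  split=> //=; apply/fP; [exists 1%:M; rewrite map_mx1| | |] => //;
    by eexists.
rewrite -trT; apply: (transfer_intertwine (T := map_mx f V)
    (T' := map_mx f (V *m invmx E'))) => //=.
- exact: resolvent_regular.
- by rewrite map_mxM map_invmx -eE mulmxKV // mul1mx.
- by rewrite -map_mxM -hA !map_mxM map_invmx -eE -eA mulmxA.
- by rewrite map_mxM -eB.
- by rewrite -map_mxM -hL eL.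
Qed.

(** The reduction is applied to the transposed pair; the smaller system then embeds into the given
    one, so [transfer_intertwine] is used in the opposite direction. *)
Lemma minimal_controllable : kalman_controllable (invmx E *m A) (invmx E *m B).
Proof.
move=> y hy; apply/eqP; rewrite -trmx_eq0; apply/negPn/negP => x0.
have [[[[/= oE oA oB oL oD] reg] trT] mn] := hmin.
have [F [f [fP fx]]] := base_field_model R K.
have [E' eE] := (fP _ _ _).1 oE; have [A' eA] := (fP _ _ _).1 oA.
have [B' eB] := (fP _ _ _).1 oB; have [L' eL] := (fP _ _ _).1 oL.
have [x' x'0 hx'] := fx _ _ x0.
have trX (A0 : 'M[R[i]]_n) j : (A0 ^+ j)^T = A0^T ^+ j.
  elim: j => [|j IH]; first by rewrite !expr0 trmx1.
  by rewrite exprS exprSr trmx_mul IH.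
have [|k [V [A2 [B2 [kn hA hB]]]]] :=
    @unobservable_reduction F n m (invmx E' *m A')^T (invmx E' *m B')^T x' x'0.
  move=> j; apply: hx'; rewrite map_mxM map_mxXn -!map_trmx !map_mxM map_invmx.
  by rewrite -eE -eA -eB -trX -!trmx_mul mulmxA hy trmx0.
have {}hA : invmx E' *m A' *m V^T = V^T *m A2^T.
  by rewrite -trmx_mul -hA trmx_mul trmxK.
have {}hB : invmx E' *m B' = V^T *m B2^T.
  by rewrite -trmx_mul -hB trmxK.
pose S' := System 1%:M (map_mx f A2^T) (map_mx f B2^T)
             (map_mx f (L' *m V^T)) D.
suff : (n <= k)%N by rewrite leqNgt kn.
apply: (mn _ S'); split.
  split; last exact: resolvent_regular.
  split=> //=; apply/fP; [exists 1%:M; rewrite map_mx1| | |] => //;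
    by eexists.
rewrite -trT; apply/esym; apply: (transfer_intertwine (T := map_mx f V^T)
    (T' := map_mx f (E' *m V^T))) => //=.
- exact: resolvent_regular.
- by rewrite map_mxM mulmx1 -eE.
- rewrite -map_mxM -mulmxA -hA !map_mxM map_invmx -eE -eA.
  by rewrite -[in LHS]mulmxA mulKVmx.
- by rewrite -map_mxM -mulmxA -hB !map_mxM map_invmx -eE -eB mulKVmx.
- by rewrite map_mxM -eL.
Qed.

End Minimality.

(** * Eigenvalues of a minimal realization as poles *)

Section Poles.
Variable C : numClosedFieldType.

Lemma kalman_observable_mx (F : fieldType) n m p (A : 'M[F]_n) (L : 'M[F]_(m, n))
    (X : 'M[F]_(n, p)) :
  kalman_observable A L -> (forall j, L *m A ^+ j *m X = 0) -> X = 0.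
Proof.
move=> obs h; apply/trmx_inj/row_matrixP => i; rewrite trmx0 row0 -tr_col.
apply/eqP; rewrite trmx_eq0; apply/eqP/obs => j.
by rewrite colE mulmxA h mul0mx.
Qed.

Lemma kalman_controllable_mx (F : fieldType) n m p (A : 'M[F]_n) (B : 'M[F]_(n, m))
    (Y : 'M[F]_(p, n)) :
  kalman_controllable A B -> (forall j, Y *m A ^+ j *m B = 0) -> Y = 0.
Proof.
move=> ctr h; apply/row_matrixP => i; rewrite row0.
by apply: ctr => j; rewrite rowE -!mulmxA [Y *m _]mulmxA h mulmx0.
Qed.

Lemma eigen_expr (F : fieldType) n p (A : 'M[F]_n) (N : 'M[F]_(n, p)) l j :
  A *m N = l *: N -> A ^+ j *m N = l ^+ j *: N.
Proof.
move=> h; elim: j => [|j IH]; first by rewrite !expr0 mul1mx scale1r.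
by rewrite exprSr -mulmxA h -scalemxAr IH scalerA -exprS.
Qed.

Lemma eigen_exprr (F : fieldType) n p (A : 'M[F]_n) (N : 'M[F]_(p, n)) l j :
  N *m A = l *: N -> N *m A ^+ j = l ^+ j *: N.
Proof.
move=> h; elim: j => [|j IH]; first by rewrite !expr0 mulmx1 scale1r.
by rewrite exprS mulmxA h -scalemxAl IH scalerA -exprS.
Qed.

Lemma mx_choice (T : Type) m n (P : 'I_m -> 'I_n -> T -> Prop) :
  (forall i j, exists v, P i j v) ->
  exists V : 'M[T]_(m, n), forall i j, P i j (V i j).
Proof.
move=> h; exists (\matrix_(i, j) projT1 (cid (h i j))) => i j; rewrite mxE.
exact: projT2.
Qed.

Lemma has_value_divX f (l : C) :
  has_value f l 0 -> exists v, has_value (f / (ratX C - ratC l)) l v.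
Proof.
move=> [p [q [ql -> /esym/eqP]]]; rewrite mulf_eq0 invr_eq0 (negbTE ql) orbF.
move=> /factor_theorem[p1 ->].
exists (p1.[l] / q.[l]), p1, q; split=> //.
rewrite tofracM tofracB -/(ratX C) -/(ratC l).
have h : ratX C - ratC l != 0.
  by rewrite -tofracB tofrac_eq0 polyXsubC_eq0.
by rewrite mulrAC mulfK.
Qed.

(* Let [N] be the value at [l] of [(s - l)^(k+1) (s - A)^-1].  Then [N] commutes
   with [A] up to the factor [l] and [L N B = 0], so [N = 0], and one factor
   [s - l] can be removed. *)
Lemma regular_resolvent n m (A : 'M[C]_n) B L (D : 'M[C]_m) (l : C) :
  kalman_observable A L -> kalman_controllable A B ->
  (forall i j, exists v, has_value (transfer (System 1%:M A B L D) i j) l v) ->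
  l *: 1%:M - A \in unitmx.
Proof.
move=> obs ctr /mx_choice[V hV].
set P := ratpencil 1%:M A; set w := ratX C - ratC l.
have [l0 hl0] := resolvent_regular A.
have uP : P \in unitmx := ratpencil_unit hl0.
have hw : has_value w l 0.
  have := has_valueD (has_value_ratX l) (has_valueN (has_value_ratC l l)).
  by rewrite subrr.
have w0 : w != 0 by rewrite /w -tofracB tofrac_eq0 polyXsubC_eq0.
have hwk k : has_value (w ^+ k.+1) l 0.
  elim: k => [//|k IH]; rewrite exprS.
  by have := has_valueM hw IH; rewrite mulr0.
have step k : (exists N, has_mxvalue (w ^+ k *: invmx P) l N) ->
    l *: 1%:M - A \in unitmx.
  elim: k => [|k IH] [N hN].
    rewrite expr0 scale1r in hN.
    have := has_mxvalueM (has_mxvalue_pencil 1%:M A l) hN.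
    rewrite -/P (mulmxV uP) => h.
    have h1 := has_mxvalue_ratC (1%:M : 'M[C]_n) l.
    rewrite map_mx1 in h1.
    by have /mulmx1_unit[] := has_mxvalue_uniq h h1.
  have h0 : has_mxvalue (w ^+ k.+1 *: 1%:M) l (0 : 'M[C]_n).
    have := has_mxvalueZ (hwk k) (has_mxvalue_ratC (1%:M : 'M[C]_n) l).
    by rewrite map_mx1 scale0r.
  have hAN : A *m N = l *: N.
    have := has_mxvalueM (has_mxvalue_pencil 1%:M A l) hN.
    rewrite -/P -scalemxAr (mulmxV uP) => /has_mxvalue_uniq/(_ h0)/eqP.
    by rewrite mulmxBl -scalemxAl mul1mx subr_eq0 => /eqP.
  have hNA : N *m A = l *: N.
    have := has_mxvalueM hN (has_mxvalue_pencil 1%:M A l).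
    rewrite -/P -scalemxAl (mulVmx uP) => /has_mxvalue_uniq/(_ h0)/eqP.
    by rewrite mulmxBr -scalemxAr mulmx1 subr_eq0 => /eqP.
  have hLNB : L *m N *m B = 0.
    have h1 := has_mxvalueM (has_mxvalueM (has_mxvalue_ratC L l) hN)
      (has_mxvalue_ratC B l).
    have h2 := has_mxvalueZ (hwk k)
      (has_mxvalueD hV (has_mxvalueN (has_mxvalue_ratC D l))).
    rewrite scale0r in h2; apply: has_mxvalue_uniq h1 _.
    rewrite -scalemxAr -scalemxAl.
    by rewrite /transfer -/(ratpencil _ _) addrK in h2.
  have hNB : N *m B = 0.
    apply: (kalman_observable_mx obs) => j.
    rewrite -mulmxA [_ ^+ _ *m _]mulmxA (eigen_expr _ hAN).
    by rewrite -scalemxAl -scalemxAr mulmxA hLNB scaler0.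
  have N0 : N = 0.
    apply: (kalman_controllable_mx ctr) => j.
    by rewrite (eigen_exprr _ hNA) -scalemxAl hNB scaler0.
  apply: IH.
  apply: (mx_choice (P := fun i j => has_value ((w ^+ k *: invmx P) i j) l)) => i j.
  have := hN i j; rewrite N0 [X in has_value _ _ X]mxE => /has_value_divX.
  rewrite -/w mxE exprSr mulrAC (mulfK w0) => -[v hv].
  by exists v; rewrite mxE.
(* The descent starts at the multiplicity [k] of [l] in [d]: by Cramer's rule [w ^+ k] cancels the
   pole of every entry of the resolvent. *)
set d := \det (polypencil 1%:M A).
have [k [q hq dq]] := multiplicity_XsubC d l.
have d0 : d != 0.
  move: (uP); rewrite unitmxE unitfE /P det_ratpencil tofrac_eq0; exact: id.
rewrite d0 /= in hq.
apply: (step k); exists (map_mx (fun p : {poly C} => p.[l] / q.[l])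
  (\adj (polypencil 1%:M A))) => i j.
rewrite [X in has_value _ _ X]mxE.
have hqn : q.[l] != 0 by [].
exists (\adj (polypencil 1%:M A) i j), q; split=> //.
have wE : w = tofrac ('X - l%:P) by rewrite tofracB.
have h : tofrac q *: (w ^+ k *: invmx P) =
    map_mx (@FracField.tofrac _) (\adj (polypencil 1%:M A)).
  rewrite -(ratpencil_mulV uP) -/d dq scalerA; congr (_ *: _).
  by rewrite tofracM tofracXn wE.
have := congr1 (fun M : 'M_n => M i j) h; rewrite mxE [in RHS]mxE => <-.
by rewrite mulrAC (mulfV (tofrac_neq0 hqn)) mul1r.
Qed.

Lemma transfer_normalize n m (E A : 'M[C]_n) B L (D : 'M[C]_m) : E \in unitmx ->
  transfer (System E A B L D) =
  transfer (System 1%:M (invmx E *m A) (invmx E *m B) L D).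
Proof.
move=> uE; apply/esym.
apply: (transfer_intertwine (T := 1%:M) (T' := invmx E)) => /=.
- have [l hl] := resolvent_regular (invmx E *m A); exists l.
  have -> : l *: E - A = E *m (l *: 1%:M - invmx E *m A).
    by rewrite mulmxBr -scalemxAr mulmx1 mulKVmx.
  by rewrite unitmx_mul uE.
- exact: resolvent_regular.
- by rewrite mulVmx // mulmx1.
- by rewrite mulmx1.
- by [].
- by rewrite mulmx1.
- by [].
Qed.

End Poles.

(** * Positive semidefinite matrices *)

Section Semidefinite.
Variable C : numClosedFieldType.

Lemma trmxCM m n p (A : 'M[C]_(m, n)) (B : 'M_(n, p)) :
  (A *m B)^t* = B^t* *m A^t*.
Proof. by rewrite trmx_mul map_mxM. Qed.

Lemma trmxCD m n (A B : 'M[C]_(m, n)) : (A + B)^t* = A^t* + B^t*.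
Proof. by rewrite linearD map_mxD. Qed.

Lemma trmxCN m n (A : 'M[C]_(m, n)) : (- A)^t* = - A^t*.
Proof. by rewrite linearN map_mxN. Qed.

Lemma trmxCZ m n c (A : 'M[C]_(m, n)) : (c *: A)^t* = c^* *: A^t*.
Proof. by rewrite linearZ map_mxZ. Qed.

Lemma trmxC0 m n : (0 : 'M[C]_(m, n))^t* = 0.
Proof. by rewrite trmx0 map_mx0. Qed.

Lemma trmxC1 n : (1%:M : 'M[C]_n)^t* = 1%:M.
Proof. by rewrite trmx1 map_mx1. Qed.

Lemma trmxC_block m1 m2 n1 n2 (a : 'M[C]_(m1, n1)) (b : 'M_(m1, n2))
    (c : 'M_(m2, n1)) (d : 'M_(m2, n2)) :
  (block_mx a b c d)^t* = block_mx (a^t*) (c^t*) (b^t*) (d^t*).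
Proof. by rewrite tr_block_mx map_block_mx. Qed.

Lemma mxtrace_conj n (A : 'M[C]_n) : \tr (A^t*) = (\tr A)^*.
Proof. by rewrite -map_trmx mxtrace_tr trace_map_mx. Qed.

Lemma gram_traceE m n (X : 'M[C]_(m, n)) :
  \tr (X^t* *m X) = \sum_j \sum_i `|X i j| ^+ 2.
Proof.
apply: eq_bigr => j _; rewrite mxE; apply: eq_bigr => i _.
by rewrite !mxE normCKC.
Qed.

Lemma gram_trace_ge0 m n (X : 'M[C]_(m, n)) : 0 <= \tr (X^t* *m X).
Proof.
by rewrite gram_traceE; do 2![apply: sumr_ge0 => ? _]; rewrite exprn_ge0.
Qed.

Lemma norm_le_gram m n (X : 'M[C]_(m, n)) i j :
  `|X i j| ^+ 2 <= \tr (X^t* *m X).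
Proof.
rewrite gram_traceE (bigD1 j) //= (bigD1 i) //= -addrA lerDl.
rewrite addr_ge0 ?sumr_ge0 // => *; rewrite ?exprn_ge0 //.
by apply: sumr_ge0 => *; rewrite exprn_ge0.
Qed.

Lemma gram_trace_eq0 m n (X : 'M[C]_(m, n)) : \tr (X^t* *m X) = 0 -> X = 0.
Proof.
move=> h; apply/matrixP => i j; rewrite mxE; apply/eqP.
have := norm_le_gram X i j; rewrite h => h0.
rewrite -normr_eq0 -[_ == _](expf_eq0 _ 2) eq_le h0 exprn_ge0 //.
Qed.

Lemma gram_trace_gt0 m n (X : 'M[C]_(m, n)) : X != 0 -> 0 < \tr (X^t* *m X).
Proof.
move=> X0; rewrite lt0r gram_trace_ge0 andbT.
by apply: contra_neq X0; exact: gram_trace_eq0.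
Qed.

Lemma gram_eq0 m n (X : 'M[C]_(m, n)) : X^t* *m X = 0 -> X = 0.
Proof. by move=> h; apply: gram_trace_eq0; rewrite h mxtrace0. Qed.

Lemma trace_congr_cols m n (M : 'M[C]_m) (W : 'M_(m, n)) :
  \tr (W^t* *m M *m W) = \sum_k ((col k W)^t* *m M *m col k W) 0 0.
Proof.
apply: eq_bigr => k _; rewrite mxE [RHS]mxE; apply: eq_bigr => i _.
rewrite [col k W i 0]mxE; congr (_ * _).
by rewrite !mxE; apply: eq_bigr => j _; rewrite !mxE.
Qed.

Lemma psd_gram m n (X : 'M[C]_(m, n)) : psdmx (X^t* *m X).
Proof.
split=> [|x]; first by rewrite trmxCM trmxCK.
by rewrite mulmxA -mulmxA -trmxCM -trace_mx11 gram_trace_ge0.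
Qed.

Lemma psdD n (A B : 'M[C]_n) : psdmx A -> psdmx B -> psdmx (A + B).
Proof.
move=> [hA pA] [hB pB]; split; first by rewrite trmxCD -hA -hB.
by move=> x; rewrite mulmxDr mulmxDl mxE addr_ge0.
Qed.

Lemma psdZ n c (A : 'M[C]_n) : 0 <= c -> psdmx A -> psdmx (c *: A).
Proof.
move=> c0 [hA pA]; split; first by rewrite trmxCZ -hA geC0_conj.
by move=> x; rewrite -scalemxAr -scalemxAl mxE mulr_ge0.
Qed.

Lemma psd_congr m n (A : 'M[C]_n) (T : 'M_(n, m)) :
  psdmx A -> psdmx (T^t* *m A *m T).
Proof.
move=> [hA pA]; split; first by rewrite !trmxCM trmxCK -hA mulmxA.
by move=> x; have := pA (T *m x); rewrite trmxCM !mulmxA.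
Qed.

(** Stated for normal matrices, since it serves Hermitian matrices as well as the skew-Hermitian
    [Om] in [trace_congr_ge0]. *)
Lemma hermitian_diagonalize n (A : 'M[C]_n) : A *m A^t* = A^t* *m A ->
  exists (P : 'M[C]_n) (d : 'rV[C]_n),
    [/\ P *m P^t* = 1%:M, P^t* *m P = 1%:M & A = P^t* *m diag_mx d *m P].
Proof.
move=> hA; have /orthomx_spectralP h : A \is normalmx by apply/normalmxP.
exists (spectralmx A), (spectral_diag A).
have u := spectral_unitarymx A; split.
- exact/unitarymxP.
- by rewrite -invmx_unitary // mulVmx // spectral_unit.
- by rewrite -invmx_unitary.
Qed.

Lemma diag_qf n (P : 'M[C]_n) (d : 'rV[C]_n) i : P *m P^t* = 1%:M ->
  (P *m (P^t* *m diag_mx d *m P) *m P^t*) i i = d 0 i.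
Proof.
move=> PP; rewrite !mulmxA PP mul1mx -mulmxA PP mulmx1.
by rewrite mxE eqxx mulr1n.
Qed.

Lemma psd_diag_ge0 n (A : 'M[C]_n) i : psdmx A -> 0 <= A i i.
Proof.
move=> [_ /(_ (delta_mx i 0))]; rewrite trmx_delta map_delta_mx.
by rewrite -rowE -colE !mxE.
Qed.

Lemma psd_factor n (A : 'M[C]_n) : psdmx A -> exists V : 'M[C]_n, A = V *m V^t*.
Proof.
move=> pA; have [hA _] := pA.
have [|P [d [PP PP' AE]]] := @hermitian_diagonalize n A; first by rewrite -hA.
have d0 i : 0 <= d 0 i.
  rewrite -(diag_qf d i PP) -AE -{1}[P]trmxCK.
  exact/psd_diag_ge0/psd_congr.
exists (P^t* *m diag_mx (\row_i sqrtC (d 0 i))).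
rewrite trmxCM trmxCK mulmxA -[_ *m diag_mx _ *m _^t*]mulmxA AE.
congr (_ *m _ *m _); apply/matrixP => i j.
rewrite tr_diag_mx map_diag_mx mulmx_diag !mxE /=; case: eqP => [->|] //.
rewrite !mulr1n /= geC0_conj ?sqrtC_ge0 // -expr2 sqrtCK //.
Qed.

Lemma psd_qf_eq0 n (A : 'M[C]_n) (x : 'cV[C]_n) :
  psdmx A -> (x^t* *m A *m x) 0 0 = 0 -> A *m x = 0.
Proof.
move=> /psd_factor[V ->] h; rewrite -mulmxA; set y := V^t* *m x.
suff -> : y = 0 by rewrite mulmx0.
apply: gram_trace_eq0; rewrite trace_mx11 /y trmxCM trmxCK.
by rewrite !mulmxA in h *.
Qed.

Lemma hermitian_pinv n (Z : 'M[C]_n) : Z = Z^t* ->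
  exists S, [/\ S = S^t*, Z *m S = S *m Z & Z *m S *m Z = Z].
Proof.
move=> hZ.
have [|P [d [PP PP' ZE]]] := @hermitian_diagonalize n Z; first by rewrite -hZ.
have dr i : (d 0 i)^* = d 0 i.
  rewrite -(diag_qf d i PP) -ZE; set X := (_ *m _).
  have hX : X = X^t* by rewrite /X !trmxCM trmxCK -hZ mulmxA.
  by move: X hX => X hX; rewrite [in RHS]hX !mxE.
(* As [0^-1 = 0], this is the Moore-Penrose inverse: [d 0 i / d 0 i] is 0 on the kernel and 1
   elsewhere. *)
pose S := P^t* *m diag_mx (\row_i (d 0 i)^-1) *m P.
have ZS : Z *m S = P^t* *m diag_mx (\row_i (d 0 i / d 0 i)) *m P.
  rewrite /S ZE !mulmxA -[_ *m P *m P^t*]mulmxA PP mulmx1.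
  rewrite -[_ *m diag_mx d *m _]mulmxA mulmx_diag.
  by congr (_ *m diag_mx _ *m _); apply/rowP => i; rewrite !mxE.
have SZ : S *m Z = P^t* *m diag_mx (\row_i (d 0 i / d 0 i)) *m P.
  rewrite /S ZE !mulmxA -[_ *m P *m P^t*]mulmxA PP mulmx1.
  rewrite -[_ *m diag_mx _ *m diag_mx d]mulmxA mulmx_diag.
  by congr (_ *m diag_mx _ *m _); apply/rowP => i; rewrite !mxE mulrC.
exists S; split; last 2 first.
- by rewrite ZS SZ.
- rewrite ZS {1}ZE !mulmxA -[_ *m P *m P^t*]mulmxA PP mulmx1.
  rewrite -[_ *m diag_mx _ *m diag_mx d]mulmxA mulmx_diag [RHS]ZE.
  congr (_ *m diag_mx _ *m _); apply/rowP => i; rewrite !mxE.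
  by have [->|d0] := eqVneq (d 0 i) 0; rewrite ?mulr0 // mulfV ?mul1r.
rewrite /S !trmxCM trmxCK mulmxA; congr (_ *m _ *m _).
rewrite tr_diag_mx map_diag_mx; congr diag_mx; apply/rowP => i.
by rewrite !mxE fmorphV /= dr.
Qed.

(* Split off from [V] the part killed by [G].  On the complementary part,
   [F V = (G V) Om] with [Om] skew-Hermitian, and an orthonormal eigenbasis of
   [Om] splits the trace into vectors satisfying [F w = l G w]. *)
Lemma trace_congr_ge0 n N p (F G : 'M[C]_(n, N)) (M : 'M[C]_N) (V : 'M[C]_(N, p)) :
  (forall w : 'cV[C]_N, G *m w = 0 \/
      (exists l, l + l^* = 0 /\ F *m w = l *: (G *m w)) ->
    0 <= (w^t* *m M *m w) 0 0) ->
  F *m V *m (G *m V)^t* + G *m V *m (F *m V)^t* = 0 ->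
  0 <= \tr (V^t* *m M *m V).
Proof.
move=> hM; set f := F *m V; set g := G *m V => /eqP.
rewrite addr_eq0 => /eqP fg.
have fE : F *m V = f by []; have gE : G *m V = g by [].
clearbody f g.
have [|S [hS ZS ZSZ]] := @hermitian_pinv p (g^t* *m g).
  by rewrite trmxCM trmxCK.
set Z := g^t* *m g in ZS ZSZ; have ZE : g^t* *m g = Z by [].
have hZ : Z = Z^t* by rewrite trmxCM trmxCK.
clearbody Z.
(* Orthogonal projection onto the complement of the kernel of [g]. *)
set Pi := Z *m S; have hPi : Pi = Pi^t* by rewrite trmxCM -hS -hZ.
have PiE : Pi = Z *m S by [].
clearbody Pi.
have PiPi : Pi *m Pi = Pi by rewrite PiE mulmxA ZSZ.
have gPi : g *m Pi = g.
  apply/esym/eqP; rewrite -subr_eq0; apply/eqP/gram_eq0.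
  rewrite trmxCD trmxCN trmxCM -hPi mulmxBl !mulmxBr !mulmxA.
  rewrite ZE -[Pi *m _ *m g]mulmxA ZE.
  have -> : Pi *m Z = Z by rewrite PiE ZSZ.
  have -> : Z *m Pi = Z by rewrite PiE ZS mulmxA ZSZ.
  by rewrite !subrr.
(* From [f g^H = - g f^H] one gets [f Pi = f g^H g S = - g f^H g S]. The additional factor [Pi],
   invisible after [g], is what makes [Om] skew-Hermitian. *)
set Om := - (Pi *m f^t* *m g *m S); have OmE0 : Om = - (Pi *m f^t* *m g *m S) by [].
clearbody Om.
have fPi : f *m Pi = g *m Om.
  rewrite OmE0 mulmxN !mulmxA gPi PiE -ZE !mulmxA fg !mulNmx //.
have OmC : Om^t* = - Om.
  rewrite OmE0 trmxCN !trmxCM trmxCK -hPi -hS opprK.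
  have -> : S *m (g^t* *m (f *m Pi)) = - (S *m Z *m f^t* *m g *m S).
    rewrite PiE -ZE !mulmxA -[S *m g^t* *m f *m g^t*]mulmxA -[S *m _ *m _]mulmxA.
    rewrite [g^t* *m (f *m _)]mulmxA -[_ *m f *m _]mulmxA fg.
    by rewrite !(mulNmx, mulmxN) !mulmxA.
  by rewrite opprK -ZS -PiE.
have [|P [d [PP PP' OmE]]] := @hermitian_diagonalize p Om.
  by rewrite OmC mulmxN mulNmx.
have dC k : d 0 k + (d 0 k)^* = 0.
  have h : (P *m Om *m P^t*)^t* = - (P *m Om *m P^t*).
    by rewrite !trmxCM trmxCK OmC mulNmx mulmxN mulmxA.
  rewrite -(diag_qf d k PP) -OmE; move: (P *m Om *m P^t*) h => X h.
  by have := congr1 (fun M : 'M_p => M k k) h; rewrite !mxE /= => ->; rewrite subrr.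
(* [P] is unitary and [Pi] a projection, so [W W^H + W2 W2^H = V V^H] and the trace splits
   accordingly. *)
pose W := V *m Pi *m P^t*.
pose W2 := V *m (1%:M - Pi).
have -> : \tr (V^t* *m M *m V) = \tr (W^t* *m M *m W) + \tr (W2^t* *m M *m W2).
  rewrite -!mulmxA ![\tr (_^t* *m _)]mxtrace_mulC -!mulmxA -raddfD -mulmxDr.
  congr (\tr (_ *m _)); rewrite /W /W2 !trmxCM trmxCK trmxCD trmxCN trmxC1 -hPi.
  rewrite !mulmxA -[_ *m P^t* *m P]mulmxA PP' mulmx1.
  rewrite -[V *m Pi *m Pi]mulmxA PiPi -[V *m (_ - _) *m _]mulmxA.
  have -> : (1%:M - Pi) *m (1%:M - Pi) = 1%:M - Pi.
    by rewrite mulmxBl mul1mx mulmxBr mulmx1 PiPi subrr subr0.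
  by rewrite -mulmxDl -mulmxDr addrC subrK mulmx1.
rewrite !trace_congr_cols addr_ge0 //; apply: sumr_ge0 => k _; apply: hM.
  right; exists (d 0 k); split=> //.
  rewrite !colE !mulmxA fE gE fPi gPi.
  have -> : g *m Om *m P^t* = g *m P^t* *m diag_mx d.
    by rewrite OmE !mulmxA -[_ *m P *m P^t*]mulmxA PP mulmx1.
  rewrite -mulmxA scalemxAr; congr (_ *m _).
  apply/matrixP => i j; rewrite mul_diag_mx !mxE.
  by have [->|] := eqVneq i k; rewrite ?mulr0.
by left; rewrite colE !mulmxA gE mulmxBr mulmx1 gPi subrr mul0mx.
Qed.

End Semidefinite.

(** * Lyapunov's theorem *)

Section Lyapunov.
Variable C : numClosedFieldType.

(** The first basis vector [e0] is an eigenvector of [A], so the inequality at [e0] reads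
    [2 Re a0 x0 < 0] and gives [x0 > 0]. On the [X]-orthogonal complement of [e0], spanned by the
    columns of [Y], [A] acts as [A1] modulo [e0], and the induction hypothesis applies to the Schur
    complement [X']. *)
Lemma lyapunov_triangular n (A X : 'M[C]_n) : X = X^t* ->
  (forall i j : 'I_n, (j < i)%N -> A i j = 0) ->
  (forall i, A i i + (A i i)^* < 0) ->
  (forall x : 'cV[C]_n, x != 0 ->
     0 < - (x^t* *m (A^t* *m X + X *m A) *m x) 0 0) ->
  psdmx X.
Proof.
elim: n A X => [|n IH] A X hX hA ha hK.
  by split=> // x; rewrite [X]flatmx0 mulmx0 mul0mx mxE.
rewrite -[n.+1]/(1 + n)%N in A X hX hA ha hK *.
pose a := ulsubmx A; pose b := ursubmx A; pose A1 := drsubmx A.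
have AE : A = block_mx a b 0 A1.
  rewrite -[LHS]submxK; congr block_mx.
  by apply/matrixP => i j; rewrite !mxE hA //= ltn_addr // ltn_ord.
pose xi := ulsubmx X; pose eta := ursubmx X; pose X1 := drsubmx X.
have XE : X = block_mx xi eta (eta^t*) X1.
  rewrite -[LHS]submxK; congr block_mx.
  by apply/matrixP => i j; rewrite !mxE {1}hX !mxE.
pose e0 : 'cV[C]_(1 + n) := col_mx 1%:M 0.
have e0X : e0^t* *m X = row_mx xi eta.
  rewrite /e0 XE tr_col_mx map_row_mx trmxC1 trmxC0 mul_row_block.
  by rewrite !mul1mx !mul0mx !addr0.
set x0 := xi 0 0; have xiE : xi = x0%:M by exact: mx11_scalar.
set a0 := a 0 0; have aE : a = a0%:M by exact: mx11_scalar.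
have Ae0 : A *m e0 = a0 *: e0.
  rewrite AE /e0 mul_block_col !mulmx1 !mulmx0 !addr0 aE.
  by rewrite scale_col_mx scaler0 scale_scalar_mx mulr1.
have e0Xe0 : e0^t* *m X *m e0 = x0%:M.
  by rewrite e0X mul_row_col mulmx1 mulmx0 addr0.
have e00 : e0 != 0.
  apply/eqP => /(congr1 usubmx); rewrite col_mxKu => /matrixP/(_ 0 0)/eqP.
  by rewrite !mxE /= oner_eq0.
have x0gt : 0 < x0.
  have := hK _ e00; rewrite mulmxDr mulmxDl !mulmxA -trmxCM Ae0.
  rewrite -[e0^t* *m X *m A *m e0]mulmxA Ae0 trmxCZ -scalemxAr -!scalemxAl e0Xe0.
  rewrite -scalerDl mxE mxE mulr1n -mulNr pmulr_rgt0 // oppr_gt0 addrC.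
  by have := ha (lshift n 0); rewrite AE block_mxEul -/a0.
pose Y : 'M[C]_(1 + n, n) := col_mx (- x0^-1 *: eta) 1%:M.
have e0XY : e0^t* *m X *m Y = 0.
  rewrite e0X mul_row_col mulmx1 xiE mul_scalar_mx scalerA mulrN mulfV ?gt_eqF //.
  by rewrite scaleN1r addNr.
have YXe0 : Y^t* *m X *m e0 = 0.
  by apply: (can_inj (@trmxCK _ _ _)); rewrite !trmxCM trmxCK -hX mulmxA e0XY trmxC0.
have AY : A *m Y = e0 *m (a *m (- x0^-1 *: eta) + b - (- x0^-1 *: eta) *m A1) + Y *m A1.
  rewrite AE mul_block_col !mulmx1 mul0mx add0r !mul_col_mx !mul1mx mul0mx.
  by rewrite add_col_mx subrK add0r.
pose X' := Y^t* *m X *m Y.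
have X'psd : psdmx X'.
  apply: (IH A1).
  - by rewrite /X' !trmxCM trmxCK -hX mulmxA.
  - by move=> i j ij; rewrite /A1 !mxE hA // ltn_add2l.
  - by move=> i; have := ha (rshift 1 i); rewrite AE block_mxEdr.
  - move=> x xn0.
    have Yx0 : Y *m x != 0.
      apply: contraNneq xn0 => /(congr1 dsubmx).
      by rewrite mul_col_mx col_mxKd mul1mx linear0 => ->.
    have := hK _ Yx0; rewrite !mulmxDr !mulmxDl !mulmxA.
    rewrite -[_ *m A *m Y]mulmxA AY.
    suff -> : (Y *m x)^t* *m A^t* *m X *m Y = x^t* *m A1^t* *m X'.
      rewrite trmxCM mulmxDr [_ *m X *m (e0 *m _)]mulmxA.
      rewrite -[x^t* *m Y^t* *m X]mulmxA -[x^t* *m _ *m e0]mulmxA YXe0.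
      by rewrite mulmx0 mul0mx add0r /X' !mulmxA.
    rewrite -trmxCM mulmxA AY mulmxDl trmxCD !trmxCM !mulmxDl.
    rewrite !mulmxA -[_ *m e0^t* *m X]mulmxA -[_ *m (e0^t* *m X) *m Y]mulmxA e0XY.
    by rewrite mulmx0 add0r.
split=> // x.
pose al := usubmx x + x0^-1 *: eta *m dsubmx x.
have xE : x = e0 *m al + Y *m dsubmx x.
  rewrite -[LHS]vsubmxK !mul_col_mx !mul1mx mul0mx add_col_mx add0r /al.
  by rewrite scaleNr mulNmx addrK.
clearbody al.
rewrite xE trmxCD !trmxCM !mulmxDl !mulmxDr !mulmxA.
set be := dsubmx x.
rewrite -[al^t* *m e0^t* *m X]mulmxA -[_ *m (e0^t* *m X) *m Y]mulmxA e0XY.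
rewrite -[be^t* *m Y^t* *m X]mulmxA -[_ *m (Y^t* *m X) *m e0]mulmxA YXe0.
rewrite !mulmx0 !mul0mx addr0 add0r -[_ *m (_ *m X) *m e0]mulmxA e0Xe0.
rewrite -[_ *m (_ *m X) *m Y]mulmxA -/X' mul_mx_scalar -scalemxAl mxE addr_ge0 //.
  by rewrite mxE mulr_ge0 ?(ltW x0gt) // -trace_mx11 gram_trace_ge0.
by case: X'psd.
Qed.

Lemma lyapunov n (A X : 'M[C]_n) : X = X^t* ->
  (forall l, 0 <= l + l^* -> l *: 1%:M - A \in unitmx) ->
  (forall x : 'cV[C]_n, x != 0 ->
     0 < - (x^t* *m (A^t* *m X + X *m A) *m x) 0 0) ->
  psdmx X.
Proof.
move=> hX hA hK; have [n0|] := posnP n.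
  by split=> // x; subst n; rewrite [X]flatmx0 mulmx0 mul0mx mxE.
(* [Schur] yields a lower triangular matrix; applied to the adjoint, it makes [A] upper
   triangular. *)
move=> n0; have [P Pu hP] := Schur (A^t*) n0.
have PP : P *m P^t* = 1%:M by exact/unitarymxP.
have PP' : P^t* *m P = 1%:M by exact/mulmx1C.
have hT : is_trig_mx (P *m A^t* *m P^t*).
  by move: hP; rewrite /similar_to conjymx.
set A' := P *m A *m P^t*; have A'D : A' = P *m A *m P^t* by [].
clearbody A'; pose X' := P *m X *m P^t*.
have A'E : A'^t* = P *m A^t* *m P^t* by rewrite A'D !trmxCM trmxCK mulmxA.
have tri (i j : 'I_n) : (j < i)%N -> A' i j = 0.
  move=> ij; move/is_trig_mxP: hT => /(_ j i ij); rewrite -A'E !mxE => /eqP.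
  by rewrite conjC_eq0 => /eqP.
have XE : X = P^t* *m X' *m P.
  by rewrite /X' !mulmxA PP' mul1mx -mulmxA PP' mulmx1.
rewrite XE; apply: psd_congr; apply: (lyapunov_triangular (A := A')) => //.
- by rewrite /X' !trmxCM trmxCK -hX mulmxA.
- move=> i; have hr : A' i i + (A' i i)^* \is Num.real.
    by apply/CrealP; rewrite rmorphD /= conjCK addrC.
  rewrite real_ltNge ?real0 //; apply/negP => /hA u.
  have : A' i i *: 1%:M - A' \in unitmx.
    have -> : A' i i *: 1%:M - A' = P *m (A' i i *: 1%:M - A) *m P^t*.
      by rewrite mulmxBr mulmxBl -scalemxAr mulmx1 -scalemxAl PP -A'D.
    by rewrite !unitmx_mul u !unitarymx_unit ?trmxC_unitary.
  rewrite unitmxE -det_tr det_trig; last first.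
    apply/is_trig_mxP => j k jk; rewrite !mxE (tri _ _ jk) subr0.
    by rewrite -val_eqE /= gtn_eqF // mulr0.
  by rewrite (bigD1 i) //= !mxE eqxx mulr1 subrr mul0r unitr0.
- move=> x x0; have Px0 : P^t* *m x != 0.
    by apply: contraNneq x0 => h; rewrite -[x]mul1mx -PP -mulmxA h mulmx0.
  have := hK _ Px0; rewrite A'E A'D /X' trmxCM trmxCK.
  rewrite !mulmxDr !mulmxDl !mulmxA -![_ *m P^t* *m P]mulmxA PP' !mulmx1; exact: id.
Qed.

End Lyapunov.

(** * Limits along ultrafilters *)

Section UltraLimits.
Import numFieldNormedType.Exports.
Local Open Scope classical_set_scope.
Variable C : numClosedFieldType.
Variable U : set_system C.
Hypothesis UU : UltraFilter U.

Definition ulim (u : C -> C) (l : C) : Prop := u @ U --> l.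

Lemma ulim_cst c : ulim (fun=> c) c.
Proof. exact: cvg_cst. Qed.

Lemma ulimD u v a b : ulim u a -> ulim v b -> ulim (fun e => u e + v e) (a + b).
Proof. by move=> hu hv; exact: cvgD hu hv. Qed.

Lemma ulimM u v a b : ulim u a -> ulim v b -> ulim (fun e => u e * v e) (a * b).
Proof. by move=> hu hv; exact: cvgM hu hv. Qed.

Lemma ulimN u a : ulim u a -> ulim (fun e => - u e) (- a).
Proof. by move=> hu; exact: cvgN hu. Qed.

Lemma ulim_sum (I : finType) (u : I -> C -> C) (a : I -> C) :
  (forall i, ulim (u i) (a i)) ->
  ulim (fun e => \sum_i u i e) (\sum_i a i).
Proof.
move=> h; elim: (index_enum I) => [|i r IH].
  by under eq_fun do rewrite big_nil; rewrite big_nil; exact: ulim_cst.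
by under eq_fun do rewrite big_cons; rewrite big_cons; exact: ulimD.
Qed.

Lemma ulim_conj u a : ulim u a -> ulim (fun e => (u e)^*) (a^*).
Proof.
move=> hu; apply/cvgrPdist_lt => e e0.
move/cvgrPdist_lt: (hu) => /(_ e e0); apply: filterS => x /=.
by rewrite -rmorphB norm_conjC.
Qed.

Lemma ulim_unique u a b : ulim u a -> ulim u b -> a = b.
Proof. by apply: cvg_unique; exact: norm_hausdorff. Qed.

Lemma ulim_eq u v a : U (fun e => u e = v e) -> ulim u a -> ulim v a.
Proof.
by move=> uv ha; apply: cvg_trans ha; apply: near_eq_cvg.
Qed.

(** Nonnegative elements are the fixed points of the norm, and the norm is continuous. *)
Lemma ulim_ge0 u a : U (fun e => 0 <= u e) -> ulim u a -> 0 <= a.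
Proof.
move=> hu ha.
have hn : ulim (fun e => `|u e|) `|a| by exact: cvg_norm ha.
have {}hn : ulim u `|a|.
  by apply: ulim_eq hn; apply: filterS hu => e he; rewrite ger0_norm.
by rewrite (ulim_unique ha hn).
Qed.

Definition mxulim m n (u : C -> 'M[C]_(m, n)) (l : 'M[C]_(m, n)) : Prop :=
  forall i j, ulim (fun e => u e i j) (l i j).

Lemma mxulim_cst m n (c : 'M_(m, n)) : mxulim (fun=> c) c.
Proof. by move=> i j; exact: ulim_cst. Qed.

Lemma mxulimD m n (u v : C -> 'M_(m, n)) a b :
  mxulim u a -> mxulim v b -> mxulim (fun e => u e + v e) (a + b).
Proof.
by move=> hu hv i j; rewrite mxE; under eq_fun do rewrite mxE; exact: ulimD.
Qed.

Lemma mxulimN m n (u : C -> 'M_(m, n)) a :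
  mxulim u a -> mxulim (fun e => - u e) (- a).
Proof.
by move=> hu i j; rewrite mxE; under eq_fun do rewrite mxE; exact: ulimN.
Qed.

Lemma mxulimZ m n (c : C -> C) (u : C -> 'M_(m, n)) d a :
  ulim c d -> mxulim u a -> mxulim (fun e => c e *: u e) (d *: a).
Proof.
by move=> hc hu i j; rewrite mxE; under eq_fun do rewrite mxE; exact: ulimM.
Qed.

Lemma mxulimM m n p (u : C -> 'M_(m, n)) (v : C -> 'M_(n, p)) a b :
  mxulim u a -> mxulim v b -> mxulim (fun e => u e *m v e) (a *m b).
Proof.
move=> hu hv i j; rewrite mxE; under eq_fun do rewrite mxE.
by apply: ulim_sum => k; exact: ulimM.
Qed.

Lemma mxulim_adj m n (u : C -> 'M_(m, n)) a :
  mxulim u a -> mxulim (fun e => (u e)^t*) (a^t*).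
Proof.
by move=> hu i j; rewrite !mxE; under eq_fun do rewrite !mxE; exact: ulim_conj.
Qed.

Lemma mxulim_row m n1 n2 (u : C -> 'M_(m, n1)) (v : C -> 'M_(m, n2)) a b :
  mxulim u a -> mxulim v b -> mxulim (fun e => row_mx (u e) (v e)) (row_mx a b).
Proof.
move=> hu hv i j; rewrite mxE; under eq_fun do rewrite mxE.
by case: (split j) => k; [exact: hu | exact: hv].
Qed.

Lemma mxulim_col m1 m2 n (u : C -> 'M_(m1, n)) (v : C -> 'M_(m2, n)) a b :
  mxulim u a -> mxulim v b -> mxulim (fun e => col_mx (u e) (v e)) (col_mx a b).
Proof.
move=> hu hv i j; rewrite mxE; under eq_fun do rewrite mxE.
by case: (split i) => k; [exact: hu | exact: hv].
Qed.

Lemma mxulim_block m1 m2 n1 n2 (ul : C -> 'M_(m1, n1)) (ur : C -> 'M_(m1, n2))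
    (dl : C -> 'M_(m2, n1)) (dr : C -> 'M_(m2, n2)) a b c d :
  mxulim ul a -> mxulim ur b -> mxulim dl c -> mxulim dr d ->
  mxulim (fun e => block_mx (ul e) (ur e) (dl e) (dr e)) (block_mx a b c d).
Proof.
by move=> hul hur hdl hdr; apply: mxulim_col; exact: mxulim_row.
Qed.

Lemma mxulim_unique m n (u : C -> 'M_(m, n)) a b :
  mxulim u a -> mxulim u b -> a = b.
Proof. by move=> ha hb; apply/matrixP => i j; exact: ulim_unique (ha i j) (hb i j). Qed.

Lemma mxulim_psd n (u : C -> 'M_n) a :
  U (fun e => psdmx (u e)) -> mxulim u a -> psdmx a.
Proof.
move=> hu ha; split.
  apply: (mxulim_unique ha) => i j.
  have h : mxulim (fun e => (u e)^t*) (a^t*) by exact: mxulim_adj.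
  by apply: ulim_eq (h i j); apply: filterS hu => e [<- _].
move=> x; apply: ulim_ge0.
  by apply: filterS hu => e /= [_ he]; exact: (he x).
suff h : mxulim (fun e => x^t* *m u e *m x) (x^t* *m a *m x) by exact: h.
by apply: mxulimM; [apply: mxulimM => // | ]; exact: mxulim_cst.
Qed.

End UltraLimits.

(* The filters live on [C] itself, so that [e -> 0] through [0 < e] needs no
   sequence.  [C] is kept abstract because [R[i]] has no canonical topology in
   the library, whereas every [numClosedFieldType] has one. *)
Definition bounded_ultra_cvg (C : numClosedFieldType) : Prop :=
  forall (U : set_system C) (u : C -> C) (b : C), UltraFilter U ->
    (forall e, `|u e| <= b) -> exists l, ulim U u l.

(** Nonnegative elements are real, so for [C = R[i]] this is the completeness of [R]. *)
Definition has_infima (C : numClosedFieldType) : Prop :=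
  forall P : C -> Prop, (exists x, P x) -> (forall x, P x -> 0 <= x) ->
  exists d, (forall x, P x -> d <= x) /\
            (forall e, 0 < e -> exists2 x, P x & x < d + e).

Section Complex.
Import numFieldNormedType.Exports.
Local Open Scope classical_set_scope.
Local Open Scope complex_scope.
Variable R : realType.

(** Compactness of [[-b, b]] gives a cluster point, and a cluster point of an ultrafilter is its
    limit. *)
Lemma real_bounded_ultra_cvg T (U : set_system T) (u : T -> R) (b : R) :
  UltraFilter U -> (forall e, `|u e| <= b) -> exists l : R, u @ U --> l.
Proof.
move=> UU hu; have [] := @segment_compact R (- b) b (u @ U) _.
  by apply: (@filterS _ U _ setT) => [e _|];
    [rewrite /= in_itv /= -ler_norml; exact: hu | exact: filterT].
move=> l [_ hl]; exists l => A Al.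
have [//|hA] := in_ultra_setVsetC (u @^-1` A) UU.
have hA' : (u @ U) (~` A) by [].
by have [y []] := hl _ _ hA' Al.
Qed.

Lemma complex_bounded_ultra_cvg : bounded_ultra_cvg R[i].
Proof.
move=> U u b UU hu.
have b0 : b = (complex.Re b)%:C.
  have := le_trans (normr_ge0 _) (hu 0); rewrite lecE => /andP[/eqP h _].
  by case: b {hu} h => x y /= ->.
have hre e : `|complex.Re (u e)| <= complex.Re b.
  rewrite -lecR -b0; apply: le_trans (hu e); rewrite normc_def lecR.
  by rewrite -sqrtr_sqr ler_wsqrtr // lerDl sqr_ge0.
have him e : `|complex.Im (u e)| <= complex.Re b.
  rewrite -lecR -b0; apply: le_trans (hu e); rewrite normc_def lecR.
  by rewrite -sqrtr_sqr ler_wsqrtr // lerDr sqr_ge0.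
have [x hx] := real_bounded_ultra_cvg UU hre.
have [y hy] := real_bounded_ultra_cvg UU him.
exists (x +i* y); apply/cvgrPdist_lt => e e0.
have e0' : 0 < complex.Re e by move: e0; rewrite ltcE => /andP[].
have eE : e = (complex.Re e)%:C.
  by move: e0; rewrite ltcE => /andP[/eqP h _]; case: e h {e0'} => ? ? /= ->.
have e2 : 0 < complex.Re e / 2%:R by rewrite divr_gt0.
move/cvgrPdist_lt: hx => /(_ _ e2) hx; move/cvgrPdist_lt: hy => /(_ _ e2) hy.
apply: filterS2 hx hy => t /= hx hy.
rewrite [X in `|X|](_ : _ = (x - complex.Re (u t))%:C
                       + 'i%C * (y - complex.Im (u t))%:C); last first.
  by case: (u t) => c d; simpc.
apply: le_lt_trans (ler_normD _ _) _.
rewrite normrM eE [complex.Re e]splitr rmorphD !normc_def /=.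
rewrite !expr0n !(addr0, add0r) !expr1n !sqrtr_sqr sqrtr1 mul1r.
by rewrite expr0n addr0 sqrtr_sqr -rmorphD ltcR ltrD.
Qed.

Lemma complex_inf : has_infima R[i].
Proof.
move=> P [x0 Px0] P0; pose S := [set x : R | P x%:C].
have PE x : P x -> x = (complex.Re x)%:C.
  by move=> /P0; rewrite lecE => /andP[/eqP h _]; case: x h => a c /= ->.
have hS : has_inf S.
  split; first by exists (complex.Re x0); rewrite /S /= -PE.
  by exists 0 => x /P0; rewrite ler0c.
exists (inf S)%:C; split=> [x Px|e e0].
  rewrite (PE _ Px) lecR; apply: ge_inf; first by case: hS.
  by rewrite /S /= -PE.
have e0' : 0 < complex.Re e by move: e0; rewrite ltcE => /andP[].
have [y Sy yl] := inf_adherent e0' hS.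
have /eqP h : complex.Im e == 0 by move: e0; rewrite ltcE => /andP[].
exists y%:C => //.
case: e h {e0} e0' yl => a c /= -> _ yl.
by rewrite -[a +i* 0]/(a%:C) -rmorphD ltcR.
Qed.
End Complex.

(** * The positive real lemma *)

Section Separation.
Variable C : numClosedFieldType.

Section RightUltrafilter.
Import numFieldNormedType.Exports.
Local Open Scope classical_set_scope.

Lemma right_ultrafilter : exists U : set_system C,
  [/\ UltraFilter U, U [set e | 0 < e] & ulim U id 0].
Proof.
pose F : set_system C := within [set e | 0 < e] (nbhs (0 : C)).
have FF : ProperFilter F.
  apply: Build_ProperFilter_ex => A; rewrite /F /within /= => /nbhs_ballP[e /= e0 he].
  exists (e / 2%:R); apply: he; last by rewrite /= divr_gt0.
  rewrite /ball /= sub0r normrN gtr0_norm ?divr_gt0 //.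
  by rewrite ltr_pdivrMr // ltr_pMr // ltr1n.
have [U [UU FU]] := ultraFilterLemma FF.
exists U; split=> //.
  by apply: FU; rewrite /F /within /=; apply: filterE.
move=> A hA; apply: FU; rewrite /F /within /=.
by apply: filterS hA.
Qed.
End RightUltrafilter.

Hypothesis hbw : bounded_ultra_cvg C.
Hypothesis hinf : has_infima C.

Lemma nonneg_slope (b c : C) : b \is Num.real -> 0 <= c ->
  (forall t, 0 < t -> t <= 1 -> 0 <= b *+ 2 + t * c) -> 0 <= b.
Proof.
move=> br c0 h; rewrite real_leNgt ?real0 //; apply/negP => b0.
have cb : 0 < c - b by rewrite ltr_wpDl // oppr_gt0.
(* This [t] lies in (0, 1], and there [2 b + t c = b (c - 2 b) / (c - b) < 0]. *)
have := h (- b / (c - b)); rewrite divr_gt0 ?oppr_gt0 // => /(_ isT).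
rewrite ler_pdivrMr // mul1r lerDr => /(_ c0).
have -> : b *+ 2 + - b / (c - b) * c = b * ((c - b *+ 2) / (c - b)).
  by field; rewrite gt_eqF.
rewrite lt_geF // nmulr_rlt0 // divr_gt0 // ltr_wpDl // oppr_gt0.
by rewrite pmulrn_llt0.
Qed.

Variables (n N : nat) (F G : 'M[C]_(n, N)) (M : 'M[C]_N).
Hypothesis hM : M = M^t*.

(** For the trace pairing, [ell] is the adjoint of [P |-> F^H P G + G^H P F], and [mu] pairs with
    [M]. On Hermitian arguments [B] is the real inner product of the pairs [(ell W, mu W)]. *)
Let ell (W : 'M[C]_N) := F *m W *m G^t* + G *m W *m F^t*.
Let mu (W : 'M[C]_N) := \tr (M *m W).
Let B W1 W2 := \tr (ell W1 *m ell W2) + mu W1 * mu W2.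

Lemma ell_lin a b W1 W2 : ell (a *: W1 + b *: W2) = a *: ell W1 + b *: ell W2.
Proof.
rewrite /ell !mulmxDr !mulmxDl -!scalemxAr -!scalemxAl !scalerDr.
by rewrite addrACA.
Qed.

Lemma mu_lin a b W1 W2 : mu (a *: W1 + b *: W2) = a * mu W1 + b * mu W2.
Proof. by rewrite /mu mulmxDr -!scalemxAr raddfD /= !mxtraceZ. Qed.

Lemma B_linr W a b W1 W2 : B W (a *: W1 + b *: W2) = a * B W W1 + b * B W W2.
Proof.
rewrite /B ell_lin mu_lin mulmxDr -!scalemxAr raddfD /= !mxtraceZ; ring.
Qed.

Lemma B_sym W1 W2 : B W1 W2 = B W2 W1.
Proof. by rewrite /B mxtrace_mulC mulrC. Qed.

Lemma ell_herm W : W = W^t* -> ell W = (ell W)^t*.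
Proof.
by move=> hW; rewrite /ell trmxCD !trmxCM !trmxCK -hW !mulmxA addrC.
Qed.

Lemma B_real W1 W2 : W1 = W1^t* -> W2 = W2^t* -> B W1 W2 \is Num.real.
Proof.
move=> h1 h2; apply/CrealP; rewrite /B rmorphD rmorphM /=.
rewrite -!mxtrace_conj !trmxCM -!ell_herm // -hM -h1 -h2.
by rewrite mxtrace_mulC [\tr (W1 *m M)]mxtrace_mulC [\tr (W2 *m M)]mxtrace_mulC.
Qed.

Lemma mu_real W : W = W^t* -> mu W \is Num.real.
Proof.
move=> h; apply/CrealP; rewrite /mu -mxtrace_conj trmxCM -hM -h.
exact: mxtrace_mulC.
Qed.

Lemma B_ge0 W : W = W^t* -> 0 <= B W W.
Proof.
move=> h; rewrite /B addr_ge0 //; last first.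
  by rewrite -expr2 -realEsqr mu_real.
by rewrite {1}(ell_herm h) gram_trace_ge0.
Qed.

Let state (W : 'M[C]_N) := psdmx W /\ \tr W = 1.

Lemma exists_minimizer : (exists W, state W) ->
  exists2 W, state W & forall W', state W' -> B W W <= B W' W'.
Proof.
move=> [W0 hW0].
have [d [dl dinf]] := @hinf (fun x => exists2 W, state W & x = B W W)
  (ex_intro _ _ (ex_intro2 _ _ W0 hW0 erefl))
  (fun x '(ex_intro2 W (conj (conj h _) _) e) => eq_ind_r (fun x => 0 <= x) (B_ge0 h) e).
(* Near-minimizers are taken in factored form [V V^H]: the unit trace then bounds the entries of [V]
   by 1. For [e] not positive a factor of [W0] is the default, so that the whole family is
   bounded. *)
have hV e : exists V : 'M[C]_N, \tr (V *m V^t*) = 1 /\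
    (0 < e -> B (V *m V^t*) (V *m V^t*) < d + e).
  have [e0|e0] := boolP (0 < e).
    have [_ [W [pW tW] ->] h] := dinf _ e0.
    by have [V WE] := psd_factor pW; exists V; rewrite -WE.
  case: hW0 => pW tW; have [V WE] := psd_factor pW.
  by exists V; rewrite -WE; split.
pose v e := projT1 (cid (hV e)).
have v1 e : \tr (v e *m (v e)^t*) = 1 by rewrite /v; case: cid => ? [].
have vd e : 0 < e -> B (v e *m (v e)^t*) (v e *m (v e)^t*) < d + e.
  by rewrite /v; case: cid => ? [].
have vb e i j : `|v e i j| <= 1.
  rewrite -(@ler_pXn2r _ 2) ?nnegrE // expr1n -(v1 e) mxtrace_mulC.
  exact: norm_le_gram.
have [U [UU Upos Uid]] := right_ultrafilter.
have [V hlim] := mx_choice (fun i j => hbw UU (fun e => vb e i j)).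
have {}hlim : mxulim U v V by exact: hlim.
have hW : mxulim U (fun e => v e *m (v e)^t*) (V *m V^t*).
  by apply: mxulimM => //; apply: mxulim_adj.
set W := V *m V^t* in hW; pose w e := v e *m (v e)^t*.
have hW' : mxulim U w W by exact: hW.
have tr_lim k (X : C -> 'M[C]_k) Y : mxulim U X Y -> ulim U (fun e => \tr (X e)) (\tr Y).
  by move=> h; apply: ulim_sum => i; exact: h.
have ell_lim : mxulim U (fun e => ell (w e)) (ell W).
  by apply: mxulimD; apply: mxulimM; [apply: mxulimM => //| |apply: mxulimM => //|];
    apply: mxulim_cst.
have B_lim : ulim U (fun e => B (w e) (w e)) (B W W).
  apply: ulimD; first by apply: tr_lim; apply: mxulimM.
  by apply: ulimM; apply: tr_lim; apply: mxulimM => //; apply: mxulim_cst.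
have sW : state W.
  split; first by rewrite /W -{1}[V]trmxCK; exact: psd_gram.
  apply: (@ulim_unique _ _ UU (fun e => \tr (w e))); first exact: tr_lim.
  have -> : (fun e => \tr (w e)) = fun=> 1 by apply/funext => e; exact: v1.
  exact: ulim_cst.
exists W => // W' sW'; apply: le_trans (dl _ (ex_intro2 _ _ W' sW' erefl)).
rewrite -[d]addr0 -subr_ge0.
apply: (@ulim_ge0 _ U UU (fun e => d + e - B (w e) (w e))).
  by apply: filterS Upos => e e0; rewrite subr_ge0 ltW // vd.
by apply: ulimD; [apply: ulimD => //; exact: ulim_cst | exact: ulimN].
Qed.

(* [P] is read off from the first-order optimality condition for minimizing
   [B W W = |ell W|^2 + (mu W)^2] over the states [W], i.e. from the point of the
   convex set of all [(ell W, mu W)] that is closest to the origin. *)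
Theorem separation :
  (forall W, state W -> ell W = 0 -> 0 < mu W) ->
  (exists2 W, state W & ell W = 0) ->
  exists2 P : 'M[C]_n, P = P^t* &
    forall w : 'cV[C]_N, w != 0 ->
      0 < (w^t* *m (F^t* *m P *m G + G^t* *m P *m F + M) *m w) 0 0.
Proof.
move=> hpos [W0 sW0 lW0].
have [|W sW hmin] := exists_minimizer; first by exists W0.
have WH : W = W^t* by case: sW => -[].
have qr := mu_real WH.
have Bpos : 0 < B W W.
  have [lW|lW] := eqVneq (ell W) 0.
    by rewrite /B lW mulmx0 mxtrace0 add0r mulr_gt0 ?hpos.
  rewrite /B ltr_wpDr //; first by rewrite -expr2 -realEsqr.
  by rewrite {1}(ell_herm WH) gram_trace_gt0.
have key W' : state W' -> 0 < B W W'.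
  move=> sW'; apply: lt_le_trans Bpos _; rewrite -subr_ge0.
  have W'H : W' = W'^t* by case: sW' => -[].
  set D := 1 *: W' + (-1) *: W.
  have DH : D = D^t*.
    by rewrite /D trmxCD !trmxCZ rmorphN !rmorph1 -WH -W'H.
  have -> : B W W' - B W W = B W D by rewrite B_linr mul1r mulN1r.
  apply: (nonneg_slope (B_real WH DH) (B_ge0 DH)) => t t0 t1.
  have sWt : state ((1 - t) *: W + t *: W').
    case: sW sW' => pW tW [pW' tW']; split.
      by apply: psdD; apply: psdZ => //; rewrite ?subr_ge0 // ltW.
    by rewrite raddfD /= !mxtraceZ tW tW' !mulr1 subrK.
  have := hmin _ sWt.
  have -> : (1 - t) *: W + t *: W' = 1 *: W + t *: D.
    by rewrite /D; apply/matrixP => i j; rewrite !mxE; ring.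
  have -> : B (1 *: W + t *: D) (1 *: W + t *: D) =
      B W W + t * (B W D *+ 2 + t * B D D).
    have BE X : B X (1 *: W + t *: D) = B X W + t * B X D.
      by rewrite B_linr mul1r.
    rewrite BE (B_sym (_ + _) W) (B_sym (_ + _) D) !BE (B_sym D W); ring.
  rewrite lerDl.
  by rewrite pmulr_rge0.
(* Tested on [W0], where [ell] vanishes, [key] reads [0 < q * mu W0]. Hence [q > 0], and dividing by
   [q] brings the coefficient of [M] to 1. *)
pose q := mu W.
have q0 : 0 < q.
  have := key _ sW0; rewrite /B lW0 mulmx0 mxtrace0 add0r.
  by rewrite pmulr_lgt0 // hpos.
exists (q^-1 *: ell W).
  by rewrite trmxCZ -ell_herm // geC0_conj // invr_ge0 ltW.
move=> w w0; have ww := gram_trace_gt0 w0.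
set c := \tr _ in ww.
have sw : state (c^-1 *: (w *m w^t*)).
  split; last by rewrite mxtraceZ mxtrace_mulC -/c mulVf // gt_eqF.
  apply: psdZ; first by rewrite invr_ge0 ltW.
  by rewrite -{1}[w]trmxCK; exact: psd_gram.
have := key _ sw; rewrite -[_ *: _]addr0 -[0 in X in B _ X](scale0r W) B_linr.
rewrite mul0r addr0 pmulr_rgt0 ?invr_gt0 // => hB.
rewrite -(pmulr_rgt0 _ q0); suff <- : B W (w *m w^t*) =
  q * (w^t* *m (F^t* *m (q^-1 *: ell W) *m G +
                G^t* *m (q^-1 *: ell W) *m F + M) *m w) 0 0 by [].
set P0 := ell W.
have H (X Y : 'M[C]_(n, N)) : \tr (P0 *m (X *m (w *m w^t*) *m Y^t*)) =
    \tr (w^t* *m (Y^t* *m P0 *m X) *m w).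
  have -> : P0 *m (X *m (w *m w^t*) *m Y^t*) =
    (P0 *m X *m w) *m (w^t* *m Y^t*) by rewrite !mulmxA.
  by rewrite mxtrace_mulC !mulmxA.
have -> : F^t* *m (q^-1 *: P0) *m G + G^t* *m (q^-1 *: P0) *m F =
    q^-1 *: (G^t* *m P0 *m F + F^t* *m P0 *m G).
  by rewrite addrC -!scalemxAr -!scalemxAl scalerDr.
rewrite -trace_mx11 mulmxDr mulmxDl raddfD /= -scalemxAr -scalemxAl mxtraceZ.
rewrite mulrDr mulrA mulfV ?gt_eqF // mul1r mulmxDr mulmxDl raddfD /= -!H.
rewrite /B -/P0 -/q /ell mulmxDr raddfD /=; congr (_ + _ * _).
by rewrite /mu mxtrace_mulC -!mulmxA mxtrace_mulC mulmxA.
Qed.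

End Separation.

(** * The perturbed inequalities and their limit *)

Definition kyp_mx (C : numClosedFieldType) n m (A : 'M[C]_n) (B : 'M[C]_(n, m))
    (L : 'M[C]_(m, n)) (H : 'M[C]_m) (X : 'M[C]_n) : 'M[C]_(n + m) :=
  block_mx (- (A^t* *m X + X *m A)) (L^t* - X *m B) (L - B^t* *m X) H.

Section KYP.
Variable C : numClosedFieldType.

Lemma qf_block n m (a : 'M[C]_n) b c (d : 'M[C]_m) (x : 'cV_n) (u : 'cV_m) :
  (col_mx x u)^t* *m block_mx a b c d *m col_mx x u =
  x^t* *m a *m x + u^t* *m c *m x + (x^t* *m b *m u + u^t* *m d *m u).
Proof.
by rewrite tr_col_mx map_row_mx mul_row_block mul_row_col !mulmxDl.
Qed.

Lemma psd_block_ul n m (a : 'M[C]_n) b c (d : 'M[C]_m) :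
  psdmx (block_mx a b c d) -> psdmx a.
Proof.
move=> [h p]; split; first by move: h; rewrite trmxC_block => /eq_block_mx[].
move=> x; have := p (col_mx x 0); rewrite qf_block trmxC0.
by rewrite !mul0mx !mulmx0 !addr0.
Qed.

(** The zero corner forces [Y B = 0]. If [Y v = 0], the form of the upper left block vanishes at
    [v], so that block kills [v] and [Y A v = 0]. Hence [Y] kills all [A ^+ j *m B]. *)
Lemma kyp_homogeneous n m (A : 'M[C]_n) (B : 'M[C]_(n, m)) (Y : 'M[C]_n) :
  kalman_controllable A B -> Y = Y^t* ->
  psdmx (block_mx (- (A^t* *m Y + Y *m A)) (- (Y *m B)) (- (B^t* *m Y)) 0) ->
  Y = 0.
Proof.
move=> ctr hY p; apply: (kalman_controllable_mx ctr) => j.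
apply/trmx_inj/row_matrixP => i; rewrite trmx0 row0 -tr_col.
apply/eqP; rewrite trmx_eq0; apply/eqP.
rewrite colE -!mulmxA; set u := delta_mx i 0.
elim: j => [|j IH].
  have := psd_qf_eq0 (x := col_mx 0 u) p.
  rewrite qf_block trmxC0 !mul0mx !mulmx0 !mul0mx !addr0 mxE => /(_ erefl).
  rewrite mul_block_col !mulmx0 mul0mx !add0r -[0 in RHS]col_mx0.
  by move=> /eq_col_mx[/eqP + _]; rewrite mulNmx oppr_eq0 expr0 mul1mx mulmxA => /eqP.
rewrite exprS -mulmxA; set v := A ^+ j *m (B *m u) in IH *; clearbody v.
have := psd_qf_eq0 (x := v) (psd_block_ul p).
rewrite mulmxN mulNmx mulmxDr mulmxDl -!mulmxA IH !mulmx0 add0r !mulmxA.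
have vY : v^t* *m Y = 0.
  by rewrite -[LHS]trmxCK trmxCM trmxCK -hY IH trmxC0.
rewrite vY !mul0mx oppr0 mxE => /(_ erefl)/eqP.
by rewrite mulNmx mulmxDl -!mulmxA IH mulmx0 add0r oppr_eq0 => /eqP.
Qed.

Hypothesis hbw : bounded_ultra_cvg C.
Hypothesis hinf : has_infima C.

Variables (n m : nat) (A : 'M[C]_n) (B : 'M[C]_(n, m)) (L : 'M[C]_(m, n)).
Variables (D M1 : 'M[C]_m).
Let H := D + D^t*.
Hypothesis stab : forall l, 0 < l + l^* -> l *: 1%:M - A \in unitmx.
Hypothesis freq : forall s, 0 < s + s^* ->
  let T := L *m invmx (s *: 1%:M - A) *m B + D in
  psdmx (T + T^t* + (s + s^*) *: M1).
Hypothesis freq_infty : forall e, 0 < e -> psdmx (H + (e + e) *: M1).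
Hypothesis m0 : (0 < m)%N.

Lemma perturbed_kyp e : 0 < e -> exists2 X, psdmx X &
  psdmx (kyp_mx (A - e%:M) B L (H + (e + e) *: M1 + e%:M) X).
Proof.
move=> e0; have eC : e^* = e by rewrite geC0_conj ?ltW.
pose A' := A - e%:M; pose He := H + (e + e) *: M1.
have He_psd : psdmx He := freq_infty e0.
have stab' l : 0 <= l + l^* -> l *: 1%:M - A' \in unitmx.
  move=> hl; have -> : l *: 1%:M - A' = (l + e) *: 1%:M - A.
    by rewrite /A' opprB scalerDl scalemx1 [_ + (e%:M - A)]addrA scalemx1.
  by apply: stab; rewrite rmorphD /= eC addrACA ltr_wpDl // addr_gt0.
(* [A'] has no eigenvalue on the imaginary axis, so [trace_congr_ge0] with [G = 1] and [M = - 1]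
   gives [- tr (V^H V) >= 0]. *)
have sing p (V : 'M[C]_(n, p)) : A' *m V *m V^t* + V *m (A' *m V)^t* = 0 -> V = 0.
  move=> h; apply: gram_trace_eq0; apply/eqP; rewrite eq_le gram_trace_ge0 andbT.
  have := @trace_congr_ge0 C n n p A' 1%:M (- 1%:M) V.
  rewrite mulmxN mulmx1 mulNmx raddfN oppr_ge0; apply; last by rewrite !mul1mx.
  move=> w; rewrite !mul1mx => hw; suff -> : w = 0 by rewrite mulmx0 mxE.
  case: hw => [//|[l [hl /eqP]]].
  rewrite -subr_eq0 -oppr_eq0 opprB -{1}[w]mul1mx scalemxAl -mulmxBl => /eqP.
  have u := stab' l; rewrite hl lexx in u.
  by move/(congr1 (mulmx (invmx (l *: 1%:M - A')))); rewrite mulKmx ?u // mulmx0.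
(* For [w = (x, u)] this means [F w = A' x + B u] and [G w = x]; the matrix delivered by
   [separation] will be [P = - X]. *)
pose F := row_mx A' B; pose G := row_mx (1%:M : 'M[C]_n) (0 : 'M_(n, m)).
pose M0 := block_mx 0 (L^t*) L He.
pose Me : 'M[C]_(n + m) := M0 + block_mx 0 0 0 e%:M.
have MeH : Me = Me^t*.
  rewrite /Me /M0 trmxCD !trmxC_block !trmxC0 trmxCK -(proj1 He_psd).
  by rewrite tr_scalar_mx map_scalar_mx /= eC.
(* If [G w = 0], only [u] is left and this is the condition at infinity. Otherwise
   [x = (s - A)^-1 B u] with [s = l + e], and [s + s^* = 2 e] matches the term [2 e M1]. *)
have M0_ge0 (w : 'cV[C]_(n + m)) : G *m w = 0 \/
    (exists l, l + l^* = 0 /\ F *m w = l *: (G *m w)) ->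
    0 <= (w^t* *m M0 *m w) 0 0.
  rewrite -[w]vsubmxK; move: (usubmx w) (dsubmx w) => x u {w}.
  rewrite /G /F /M0 !mul_row_col qf_block mul1mx mul0mx addr0 mulmx0 mul0mx add0r.
  case=> [->|[l [hl hx]]].
    rewrite trmxC0 mulmx0 !mul0mx !add0r; exact: (proj2 He_psd).
  have le0 : 0 < (l + e) + (l + e)^*.
    by rewrite rmorphD /= eC addrACA hl add0r addr_gt0.
  have us := stab le0; have := freq le0.
  set T := _ *m _ *m _ + _ => /proj2/(_ u).
  have xE : x = invmx ((l + e) *: 1%:M - A) *m B *m u.
    rewrite -[LHS](mulKmx us) -[RHS]mulmxA; congr (_ *m _).
    rewrite mulmxBl -scalemxAl mul1mx scalerDl -hx /A' mulmxBl mul_scalar_mx.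
    move: (A *m x) (e *: x) (B *m u) => a b c.
    by apply/matrixP => i j; rewrite !mxE; ring.
  have LxE : L *m x + D *m u = T *m u by rewrite xE /T mulmxDl !mulmxA.
  clearbody T.
  congr (_ <= _ 0 0).
  have -> : (l + e) + (l + e)^* = e + e.
    by rewrite rmorphD /= eC addrACA hl add0r.
  rewrite /He /H.
  have -> : x^t* *m L^t* *m u = (L *m x)^t* *m u by rewrite trmxCM.
  rewrite -[u^t* *m L *m x]mulmxA.
  have -> : L *m x = T *m u - D *m u by rewrite -LxE addrK.
    rewrite trmxCD trmxCN !trmxCM.
  rewrite !(mulmxDr, mulmxDl, mulmxBr, mulmxBl, mulNmx, mulmxN) !mulmxA.
  move: (_ *m D *m u) (_ *m D^t* *m u) (_ *m T *m u) (_ *m T^t* *m u)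
    (_ *m (_ *: M1) *m u) => a b c d f.
  by rewrite (addrC a b) -!addrA addKr [d + (a + f)]addrCA addKr.
have [||P PH Ppos] := separation hbw hinf (F := F) (G := G) (M := Me) MeH.
(* [mu W] exceeds a nonnegative number by [e |V2|^2], with [V2] the input part of [V]. If [V2 = 0],
   then [ell W = 0] becomes the equation in [sing] and forces [V = 0], against the unit trace. *)
- move=> W [pW tW] lW; have [V WE] := psd_factor pW.
  have lV : F *m V *m (G *m V)^t* + G *m V *m (F *m V)^t* = 0.
    by rewrite -lW WE !trmxCM !mulmxA.
  have ge0 := trace_congr_ge0 M0_ge0 lV.
  have VE : V = col_mx (usubmx V) (dsubmx V) by rewrite vsubmxK.
  have muE : \tr (Me *m W) = \tr (V^t* *m M0 *m V) +
      e * \tr ((dsubmx V)^t* *m dsubmx V).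
    rewrite /Me mulmxDl raddfD /= WE !mulmxA; congr (_ + _).
      by rewrite mxtrace_mulC !mulmxA.
    rewrite mxtrace_mulC !mulmxA {1 2}VE tr_col_mx map_row_mx mul_row_block.
    rewrite !mulmx0 !add0r mul_row_col mul0mx add0r mul_mx_scalar -scalemxAl.
    by rewrite mxtraceZ.
  rewrite muE; have [V2|V2] := eqVneq (dsubmx V) 0; last first.
    by rewrite ltr_wpDl // mulr_gt0 // gram_trace_gt0.
  have V1 : usubmx V = 0.
    apply: sing; move: lV; rewrite VE V2 /F /G !mul_row_col !mulmx0 !addr0 mul1mx.
    by rewrite col_mxKu.
  by move: tW; rewrite WE VE V1 V2 col_mx0 mul0mx mxtrace0 => /esym/eqP;
    rewrite oner_eq0.
(* Vectors [(0, u)] are killed by [G], so they give states with [ell = 0]; a nonzero one exists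
   because [m > 0]. *)
- pose v : 'cV[C]_(n + m) := col_mx 0 (delta_mx (Ordinal m0) 0).
  have Gv : G *m v = 0 by rewrite /G /v mul_row_col mulmx0 mul0mx addr0.
  exists (v *m v^t*).
    split; first by rewrite -{1}[v]trmxCK; exact: psd_gram.
    rewrite mxtrace_mulC /v tr_col_mx map_row_mx mul_row_col mulmx0 add0r.
    by rewrite trmx_delta map_delta_mx mul_delta_mx trace_mx11 !mxE.
  by rewrite !mulmxA Gv !mul0mx addr0 -mulmxA -trmxCM Gv trmxC0 mulmx0.
pose X := - P.
have XH : X = X^t* by rewrite /X trmxCN -PH.
have kypE : kyp_mx A' B L (He + e%:M) X = F^t* *m P *m G + G^t* *m P *m F + Me.
  rewrite /kyp_mx /F /G /Me /M0 !tr_row_mx !map_col_mx trmxC1 trmxC0.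
  rewrite !mul_col_mx !mul_mx_row !mul0mx !mul1mx !mulmx0 !mulmx1.
  rewrite -!/(block_mx _ _ _ _) !add_block_mx !addr0 !add0r /X !(mulmxN, mulNmx).
  congr block_mx; first by rewrite opprD !opprK.
    by rewrite opprK addrC.
  by rewrite opprK addrC.
have qf (w : 'cV[C]_(n + m)) : w != 0 ->
    0 < (w^t* *m kyp_mx A' B L (He + e%:M) X *m w) 0 0.
  by rewrite kypE; exact: Ppos.
clearbody Me; exists X.
  apply: (lyapunov XH stab') => x x0.
  have : col_mx x (0 : 'cV[C]_m) != 0.
    by apply: contraNneq x0 => /(congr1 usubmx); rewrite col_mxKu linear0 => ->.
  move=> /qf; rewrite /kyp_mx qf_block trmxC0 !mul0mx !mulmx0 !addr0.
  by rewrite mulmxN mulNmx [X in 0 < X -> _]mxE.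
split.
  rewrite -/A' -/He kypE !trmxCD !trmxCM !trmxCK -PH -MeH !mulmxA.
  by rewrite [F^t* *m _ *m _ + _]addrC.
move=> w; have [->|w0] := eqVneq w 0; first by rewrite mulmx0 mxE.
exact/ltW/qf.
Qed.

(* The perturbed solutions [X] may blow up as [e] tends to [0], so the pair
   [(X, 1)] is rescaled to stay bounded; controllability keeps the limit of the
   second component away from [0]. *)
Theorem kyp_lemma : kalman_controllable A B ->
  exists2 X, psdmx X & psdmx (kyp_mx A B L H X).
Proof.
move=> ctr.
have [X hX] : exists X : C -> 'M[C]_n, forall e, 0 < e -> psdmx (X e) /\
    psdmx (kyp_mx (A - e%:M) B L (H + (e + e) *: M1 + e%:M) (X e)).
  have h e : exists X : 'M[C]_n, 0 < e -> psdmx X /\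
      psdmx (kyp_mx (A - e%:M) B L (H + (e + e) *: M1 + e%:M) X).
    have [e0|_] := boolP (0 < e); last by exists 0.
    by have [X pX pK] := perturbed_kyp e0; exists X.
  by exists (fun e => projT1 (cid (h e))) => e; case: cid.
pose nu e := sqrtC (\tr ((X e)^t* *m X e)).
have nu0 e : 0 <= nu e by rewrite sqrtC_ge0 gram_trace_ge0.
(* With this factor, [r e] and the Frobenius norm of [r e *: X e] add up to 1, so the limits [rho]
   and [Y0] cannot both vanish. *)
pose r e := (1 + nu e)^-1.
have r0 e : 0 < r e by rewrite invr_gt0 ltr_pwDl.
have rnu e : r e * nu e = 1 - r e.
  have h : r e * (1 + nu e) = 1 by rewrite mulVf // gt_eqF // ltr_pwDl.
  by rewrite -[in RHS]h mulrDr mulr1 addrAC subrr add0r.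
have r1 e : `|r e| <= 1.
  rewrite gtr0_norm // -subr_ge0 -rnu mulr_ge0 //; exact: ltW.
pose Y e := r e *: X e.
have Yb e i j : `|Y e i j| <= 1.
  rewrite mxE normrM gtr0_norm //; apply: le_trans (_ : r e * nu e <= _).
    rewrite ler_pM2l // -(@ler_pXn2r _ 2) ?nnegrE // sqrtCK.
    exact: norm_le_gram.
  by rewrite rnu lerBlDr lerDl ltW.
have trY e : \tr ((Y e)^t* *m Y e) = (1 - r e) * (1 - r e).
  rewrite -rnu /Y trmxCZ -scalemxAr -scalemxAl !mxtraceZ geC0_conj ?ltW //.
  by rewrite mulrACA -expr2 -expr2 sqrtCK expr2 mulrA.
have [U [UU Upos Uid]] := right_ultrafilter C.
have [Y0 hlim] := mx_choice (fun i j => hbw UU (fun e => Yb e i j)).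
have {}hlim : mxulim U Y Y0 by exact: hlim.
have [rho hr] := hbw UU r1.
have rho0 : 0 <= rho.
  apply: (@ulim_ge0 _ U UU r) => //.
  by apply: filterS Upos => e _; exact: ltW.
have Y0psd : psdmx Y0.
  apply: (@mxulim_psd _ U UU _ Y) => //.
  by apply: filterS Upos => e /hX[pX _]; apply: psdZ => //; exact: ltW.
have trY0 : \tr (Y0^t* *m Y0) = (1 - rho) * (1 - rho).
  apply: (@ulim_unique _ U UU (fun e => \tr ((Y e)^t* *m Y e))).
    have h : mxulim U (fun e => (Y e)^t* *m Y e) (Y0^t* *m Y0).
      by apply: mxulimM => //; apply: mxulim_adj.
    by apply: ulim_sum => i; exact: h.
  have -> : (fun e => \tr ((Y e)^t* *m Y e)) = (fun e => (1 - r e) * (1 - r e)).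
    exact/funext.
  by apply: ulimM; apply: ulimD;
    [exact: ulim_cst | exact: ulimN | exact: ulim_cst | exact: ulimN].
pose K e := block_mx (- ((A - e%:M)^t* *m Y e + Y e *m (A - e%:M)))
  (r e *: L^t* - Y e *m B) (r e *: L - B^t* *m Y e)
  (r e *: (H + (e + e) *: M1 + e%:M)).
have Kpsd e : 0 < e -> psdmx (K e).
  move=> /hX[_ pK].
  suff -> : K e = r e *: kyp_mx (A - e%:M) B L (H + (e + e) *: M1 + e%:M) (X e).
    by apply: psdZ => //; exact: ltW.
  rewrite /K /kyp_mx scale_block_mx scalerN !scalerBr /Y.
  by rewrite -!scalemxAr -!scalemxAl -scalerDr.
have eM k : mxulim U (fun e => e%:M : 'M[C]_k) 0.
  move=> i j; rewrite mxE; have -> : (fun e => (e%:M : 'M[C]_k) i j) =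
    (fun e => e * (i == j)%:R) by apply/funext => e; rewrite mxE mulr_natr.
  by rewrite -[X in ulim _ _ X](mul0r (i == j)%:R); apply: ulimM => //; exact: ulim_cst.
have Ae : mxulim U (fun e => A - e%:M) A.
  rewrite -[X in mxulim _ _ X]subr0; apply: mxulimD; first exact: mxulim_cst.
  exact: mxulimN.
have Klim : mxulim U K (block_mx (- (A^t* *m Y0 + Y0 *m A))
    (rho *: L^t* - Y0 *m B) (rho *: L - B^t* *m Y0) (rho *: H)).
  apply: mxulim_block.
  - apply: mxulimN; apply: mxulimD; apply: mxulimM => //; exact: mxulim_adj.
  - apply: mxulimD; first by apply: mxulimZ => //; exact: mxulim_cst.
    by apply: mxulimN; apply: mxulimM => //; exact: mxulim_cst.
  - apply: mxulimD; first by apply: mxulimZ => //; exact: mxulim_cst.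
    by apply: mxulimN; apply: mxulimM => //; exact: mxulim_cst.
  - apply: mxulimZ => //; rewrite -[X in mxulim _ _ X]addr0.
    apply: mxulimD => //; rewrite -[X in mxulim _ _ X]addr0.
    apply: mxulimD; first exact: mxulim_cst.
    rewrite -(scale0r M1) -[0](addr0 (0 : C)).
    by apply: mxulimZ; [exact: ulimD | exact: mxulim_cst].
have pK : psdmx (block_mx (- (A^t* *m Y0 + Y0 *m A))
    (rho *: L^t* - Y0 *m B) (rho *: L - B^t* *m Y0) (rho *: H)).
  by apply: (@mxulim_psd _ U UU _ K) => //; apply: filterS Upos.
(* For [rho = 0] the limit inequality is homogeneous and gives [Y0 = 0], although [Y0] has norm
   1. *)
have [rho00|rhon0] := eqVneq rho 0.
  have Y00 : Y0 = 0.
    apply: (kyp_homogeneous ctr); first by case: Y0psd.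
    by move: pK; rewrite rho00 !scale0r !add0r.
  move: trY0; rewrite Y00 rho00 subr0 mulr1 mulmx0 mxtrace0 => /esym/eqP.
  by rewrite oner_eq0.
have rhoV : 0 <= rho^-1 by rewrite invr_ge0.
exists (rho^-1 *: Y0); first exact: psdZ.
suff -> : kyp_mx A B L H (rho^-1 *: Y0) = rho^-1 *: (block_mx (- (A^t* *m Y0 + Y0 *m A))
    (rho *: L^t* - Y0 *m B) (rho *: L - B^t* *m Y0) (rho *: H)) by exact: psdZ.
rewrite /kyp_mx scale_block_mx scalerN scalerDr !scalerBr !scalerA mulVf //.
by rewrite !scale1r -!scalemxAr -!scalemxAl.
Qed.

End KYP.

(** * Invertibility and realness of the storage matrix *)

Section StorageMatrix.
Variable C : numClosedFieldType.

Lemma unitmx_ker0 (F : fieldType) n (X : 'M[F]_n) :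
  (forall x : 'cV[F]_n, X *m x = 0 -> x = 0) -> X \in unitmx.
Proof.
move=> h; rewrite -unitmx_tr unitmxE unitfE; apply/negP => /det0P[v v0 hv].
move: v0; rewrite -trmx_eq0 (h v^T) ?eqxx //.
by rewrite -[X]trmxK -trmx_mul hv trmx0.
Qed.

(** The kernel of [X] is stable under [A] and contained in that of [L]: for [X v = 0] the form
    vanishes at [(v, 0)], and a semidefinite matrix kills every vector on which its form
    vanishes. *)
Lemma kyp_unit n m (A : 'M[C]_n) (B : 'M[C]_(n, m)) L H X :
  kalman_observable A L -> psdmx X -> psdmx (kyp_mx A B L H X) ->
  X \in unitmx.
Proof.
move=> obs [hX _] pK; apply: unitmx_ker0 => x hx; apply: obs.
have step (v : 'cV_n) : X *m v = 0 -> X *m (A *m v) = 0 /\ L *m v = 0.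
  move=> hv; have vX : v^t* *m X = 0.
    by rewrite -[LHS]trmxCK trmxCM trmxCK -hX hv trmxC0.
  have := psd_qf_eq0 (x := col_mx v 0) pK.
  rewrite /kyp_mx qf_block trmxC0 !mul0mx !mulmx0 !addr0.
  rewrite mulmxN mulNmx mulmxDr mulmxDl -[v^t* *m _ *m v]mulmxA.
  rewrite -[A^t* *m X *m v]mulmxA hv.
  rewrite !mulmx0 add0r !mulmxA vX !mul0mx oppr0 mxE => /(_ erefl).
  rewrite mul_block_col !mulmx0 !addr0 -[0 in RHS]col_mx0 => /eq_col_mx[].
  rewrite mulNmx mulmxDl -!mulmxA hv mulmx0 add0r mulmxBl -mulmxA hv mulmx0 subr0.
  by move/eqP; rewrite oppr_eq0 => /eqP.
have XA j : X *m (A ^+ j *m x) = 0.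
  elim: j => [|j IH]; first by rewrite expr0 mul1mx.
  by rewrite exprS -mulmxA; case: (step _ IH).
by move=> j; rewrite -mulmxA; case: (step _ (XA j)).
Qed.

Local Notation cj M := (map_mx Num.conj M).

Lemma trmxC_conj m n (M : 'M[C]_(m, n)) : (cj M)^t* = cj (M^t*).
Proof. by apply/matrixP => i j; rewrite !mxE. Qed.

Lemma psd_conj n (M : 'M[C]_n) : psdmx M -> psdmx (cj M).
Proof.
move=> [hM pM]; split; first by rewrite trmxC_conj -hM.
move=> x; have := pM (cj x); rewrite -conjC_ge0; congr (_ <= _).
rewrite trmxC_conj; have -> : x = cj (cj x).
  by apply/matrixP => i j; rewrite !mxE conjCK.
rewrite -!map_mxM [RHS]mxE; congr (_ _).
by congr ((_ *m _ *m _) 0 0); apply/matrixP => i j; rewrite !mxE conjCK.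
Qed.

Lemma kyp_conj n m (A : 'M[C]_n) (B : 'M[C]_(n, m)) L H X :
  cj (kyp_mx A B L H X) = kyp_mx (cj A) (cj B) (cj L) (cj H) (cj X).
Proof.
by rewrite /kyp_mx map_block_mx map_mxN map_mxD !map_mxB !map_mxM !trmxC_conj.
Qed.

Lemma half_double n m (M : 'M[C]_(n, m)) : 2%:R^-1 *: (M + M) = M.
Proof. by rewrite -mulr2n -scaler_nat scalerA mulVf ?pnatr_eq0 // scale1r. Qed.

Lemma kyp_mean n m (A : 'M[C]_n) (B : 'M[C]_(n, m)) L H X Y :
  kyp_mx A B L H (2%:R^-1 *: (X + Y)) =
  2%:R^-1 *: (kyp_mx A B L H X + kyp_mx A B L H Y).
Proof.
rewrite /kyp_mx add_block_mx scale_block_mx half_double; congr block_mx.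
- rewrite -scalemxAr -scalemxAl -scalerDr -scalerN mulmxDl mulmxDr -opprD.
  by congr (_ *: - _); rewrite addrACA.
- by rewrite -{1}[L^t*]half_double -scalemxAl -scalerBr mulmxDl opprD addrACA.
- by rewrite -{1}[L]half_double -scalemxAr -scalerBr mulmxDr opprD addrACA.
Qed.

Lemma mx_over_real m n (M : 'M[C]_(m, n)) : mx_over RealBase M <-> cj M = M.
Proof.
split=> [/mxOverP h|h].
  by apply/matrixP => i j; rewrite mxE; apply/CrealP; exact: h.
by apply/mxOverP => i j; apply/CrealP; rewrite -[in RHS]h mxE.
Qed.

(** For real data the solution set is convex and closed under entrywise conjugation, hence contains
    the real part of each solution. *)
Lemma kyp_base (K : base_field) n m (A : 'M[C]_n) (B : 'M[C]_(n, m)) L H X :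
  mx_over K A -> mx_over K B -> mx_over K L -> mx_over K H ->
  psdmx X -> psdmx (kyp_mx A B L H X) ->
  exists X', [/\ mx_over K X', psdmx X' & psdmx (kyp_mx A B L H X')].
Proof.
case: K; last by exists X; split=> //; apply/mxOverP.
move=> /mx_over_real hA /mx_over_real hB /mx_over_real hL /mx_over_real hH pX pK.
have h2 : 0 <= 2%:R^-1 :> C by rewrite invr_ge0 ler0n.
exists (2%:R^-1 *: (X + cj X)); split.
- apply/mx_over_real; rewrite map_mxZ map_mxD /= geC0_conj // addrC; congr (_ *: (_ + _)).
  by apply/matrixP => i j; rewrite !mxE conjCK.
- by apply: psdZ => //; apply: psdD => //; exact: psd_conj.
- rewrite kyp_mean; apply: psdZ => //; apply: psdD => //.
  by rewrite -{1}hA -{1}hB -{1}hL -{1}hH -kyp_conj; exact: psd_conj.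
Qed.

Lemma psd_block_diag n m (a : 'M[C]_n) (d : 'M[C]_m) :
  psdmx a -> psdmx d -> psdmx (block_mx a 0 0 d).
Proof.
move=> [ha pa] [hd pd]; split; first by rewrite trmxC_block !trmxC0 -ha -hd.
move=> x; rewrite -[x]vsubmxK qf_block !mulmx0 !mul0mx addr0 add0r mxE.
exact: addr_ge0.
Qed.

Lemma psd_flat n (a : 'M[C]_n) : n = 0 -> psdmx a.
Proof.
move=> n0; subst n; split=> [|x]; first by rewrite [a]flatmx0 [RHS]flatmx0.
by rewrite [x]flatmx0 mulmx0 mxE.
Qed.

Lemma qf_bound n (x : 'cV[C]_n) (M : 'M[C]_n) (e : C) :
  (forall i j, `|M i j| <= e) ->
  `|(x^t* *m M *m x) 0 0| <= e * \sum_i \sum_j `|x j 0| * `|x i 0|.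
Proof.
move=> h; rewrite mxE mulr_sumr; apply: le_trans (ler_norm_sum _ _ _) _.
apply: ler_sum => i _; rewrite mxE mulr_suml mulr_sumr.
apply: le_trans (ler_norm_sum _ _ _) _; apply: ler_sum => j _.
rewrite !normrM !mxE norm_conjC mulrAC mulrC ler_wpM2r ?mulr_ge0 //.
Qed.

End StorageMatrix.

(** * Matrices over the base field and the port-Hamiltonian form *)

Section BaseField.
Variables (R : realType) (K : base_field).

Lemma mx_overD m n (M N : 'M[R[i]]_(m, n)) :
  mx_over K M -> mx_over K N -> mx_over K (M + N).
Proof.
have [F [f [fP _]]] := base_field_model R K.
by move=> /fP[M' ->] /fP[N' ->]; apply/fP; exists (M' + N'); rewrite map_mxD.
Qed.

Lemma mx_overN m n (M : 'M[R[i]]_(m, n)) : mx_over K M -> mx_over K (- M).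
Proof.
have [F [f [fP _]]] := base_field_model R K.
by move=> /fP[M' ->]; apply/fP; exists (- M'); rewrite map_mxN.
Qed.

Lemma mx_overM m n p (M : 'M[R[i]]_(m, n)) (N : 'M_(n, p)) :
  mx_over K M -> mx_over K N -> mx_over K (M *m N).
Proof.
have [F [f [fP _]]] := base_field_model R K.
by move=> /fP[M' ->] /fP[N' ->]; apply/fP; exists (M' *m N'); rewrite map_mxM.
Qed.

Lemma mx_over_inv n (M : 'M[R[i]]_n) : mx_over K M -> mx_over K (invmx M).
Proof.
have [F [f [fP _]]] := base_field_model R K.
by move=> /fP[M' ->]; apply/fP; exists (invmx M'); rewrite map_invmx.
Qed.

Lemma mx_over_nat_scale m n k (M : 'M[R[i]]_(m, n)) :
  mx_over K M -> mx_over K (k%:R *: M).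
Proof.
have [F [f [fP _]]] := base_field_model R K.
by move=> /fP[M' ->]; apply/fP; exists (k%:R *: M'); rewrite map_mxZ rmorph_nat.
Qed.

Lemma mx_over_natV_scale m n k (M : 'M[R[i]]_(m, n)) :
  mx_over K M -> mx_over K (k%:R^-1 *: M).
Proof.
have [F [f [fP _]]] := base_field_model R K.
by move=> /fP[M' ->]; apply/fP; exists (k%:R^-1 *: M');
  rewrite map_mxZ fmorphV rmorph_nat.
Qed.

Lemma mx_over0 m n : mx_over K (0 : 'M[R[i]]_(m, n)).
Proof.
have [F [f [fP _]]] := base_field_model R K.
by apply/fP; exists 0; rewrite map_mx0.
Qed.

Lemma mx_over1 n : mx_over K (1%:M : 'M[R[i]]_n).
Proof.
have [F [f [fP _]]] := base_field_model R K.
by apply/fP; exists 1%:M; rewrite map_mx1.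
Qed.

Lemma mx_over_adj m n (M : 'M[R[i]]_(m, n)) : mx_over K M -> mx_over K (M^t*).
Proof.
move=> /mxOverP h; apply/mxOverP => i j; rewrite !mxE.
by have := h j i; case: (K) => //= hr; rewrite /in_base unfold_in /= CrealJ.
Qed.

Lemma mx_over_row m n1 n2 (M : 'M[R[i]]_(m, n1)) (N : 'M_(m, n2)) :
  mx_over K M -> mx_over K N -> mx_over K (row_mx M N).
Proof.
have [F [f [fP _]]] := base_field_model R K.
by move=> /fP[M' ->] /fP[N' ->]; apply/fP; exists (row_mx M' N'); rewrite map_row_mx.
Qed.

Lemma mx_over_col m1 m2 n (M : 'M[R[i]]_(m1, n)) (N : 'M_(m2, n)) :
  mx_over K M -> mx_over K N -> mx_over K (col_mx M N).
Proof.
have [F [f [fP _]]] := base_field_model R K.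
by move=> /fP[M' ->] /fP[N' ->]; apply/fP; exists (col_mx M' N'); rewrite map_col_mx.
Qed.

Lemma mx_over_block m1 m2 n1 n2 (a : 'M[R[i]]_(m1, n1)) (b : 'M_(m1, n2))
    (c : 'M_(m2, n1)) (d : 'M_(m2, n2)) :
  mx_over K a -> mx_over K b -> mx_over K c -> mx_over K d ->
  mx_over K (block_mx a b c d).
Proof. by move=> *; apply: mx_over_col; exact: mx_over_row. Qed.

Lemma port_Hamiltonian_of_lmi n m (E A Q : 'M[R[i]]_n) B L (D : 'M[R[i]]_m) :
  mx_over K A -> mx_over K B -> mx_over K L -> mx_over K D -> mx_over K Q ->
  Q \in unitmx -> psdmx (Q^t* *m E) ->
  psdmx (block_mx (- (A^t* *m Q + Q^t* *m A)) (L^t* - Q^t* *m B)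
                  (L - B^t* *m Q) (D + D^t*)) ->
  port_Hamiltonian K (System E A B L D) Q.
Proof.
move=> oA oB oL oD oQ uQ pE pW; split=> //.
have hc : (2%:R^-1)^* = 2%:R^-1 :> R[i] by rewrite geC0_conj // invr_ge0 ler0n.
pose Z := A *m invmx Q; pose Y := (invmx Q)^t* *m L^t*.
have oZ : mx_over K Z := mx_overM oA (mx_over_inv oQ).
have oY : mx_over K Y := mx_overM (mx_over_adj (mx_over_inv oQ)) (mx_over_adj oL).
have ZQ : Z *m Q = A by rewrite mulmxKV.
have YQ : Y^t* *m Q = L by rewrite trmxCM !trmxCK mulmxKV.
clearbody Z Y.
have QY : Q^t* *m Y = L^t* by rewrite -YQ trmxCM trmxCK.
have QZ : Q^t* *m Z^t* = A^t* by rewrite -ZQ trmxCM.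
(* [J - R] and [S0 + N] split [Z = A Q^-1] and [D] into Hermitian and skew-Hermitian parts; [G] and
   [P] solve [G - P = B] and [G + P = Y] with [Y = Q^-H L^H]. Then [W] is half the matrix of the
   inequality. *)
exists (2%:R^-1 *: (Z - Z^t*)), (- (2%:R^-1 *: (Z + Z^t*))).
exists (2%:R^-1 *: (B + Y)), (2%:R^-1 *: (Y - B)).
exists (2%:R^-1 *: (D + D^t*)), (2%:R^-1 *: (D - D^t*)).
split.
  split.
  - exact: mx_over_natV_scale (mx_overD oZ (mx_overN (mx_over_adj oZ))).
  - exact: mx_overN (mx_over_natV_scale _ (mx_overD oZ (mx_over_adj oZ))).
  - exact: mx_over_natV_scale (mx_overD oB oY).
  - exact: mx_over_natV_scale (mx_overD oY (mx_overN oB)).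
split.
  split.
  - exact: mx_over_natV_scale (mx_overD oD (mx_over_adj oD)).
  - exact: mx_over_natV_scale (mx_overD oD (mx_overN (mx_over_adj oD))).
split.
- rewrite /= opprK -!scalerDr -!scalerBr.
  have -> : Z - Z^t* + (Z + Z^t*) = Z + Z by rewrite addrCA subrK.
  have -> : B + Y - (Y - B) = B + B by rewrite opprB addrACA subrr addr0.
  have -> : B + Y + (Y - B) = Y + Y by rewrite [Y - B]addrC addrACA subrr add0r.
  have -> : D + D^t* + (D - D^t*) = D + D by rewrite addrACA subrr addr0.
  by rewrite !half_double ZQ YQ.
- by split=> //=; have [h _] := pE; rewrite h trmxCM trmxCK.
- rewrite /= trmxC_block !trmxCZ !hc !trmxCN !trmxCZ !hc !trmxCD !trmxCN !trmxCK.
  rewrite opp_block_mx !opprK -!scalerN !opprD !opprK.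
  by rewrite [- Z^t* + Z]addrC [- D^t* + D]addrC.
- cbv zeta; set W := block_mx _ _ _ _.
  suff pW' : psdmx W by split; [exact: (proj1 pW') | exact: pW'].
  have -> : W = 2%:R^-1 *: (block_mx (- (A^t* *m Q + Q^t* *m A))
      (L^t* - Q^t* *m B) (L - B^t* *m Q) (D + D^t*)).
    rewrite /W scale_block_mx mulmxN mulNmx scalerN -!scalemxAr -!scalemxAl.
    rewrite mulmxDr mulmxDl -[Q^t* *m Z *m Q]mulmxA ZQ QZ [A^t* *m Q + _]addrC.
    by rewrite mulmxBr QY trmxCZ hc -scalemxAl trmxCD trmxCN mulmxBl YQ.
  by apply: psdZ pW; rewrite invr_ge0 ler0n.
Qed.

End BaseField.

(** * The port-Hamiltonian extension *)

Section Augmentation.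

(** The inverse carries [N] in its last corner. With [N = s M1], the blocks [(0, 1)] of the extended
    input and output matrices select exactly this corner, which produces the polynomial part. *)
Lemma augmented_inv (F : fieldType) n m (P : 'M[F]_n) (N : 'M[F]_m) :
  P \in unitmx ->
  block_mx P 0 0 (block_mx N 1%:M (- 1%:M) 0) \in unitmx /\
  invmx (block_mx P 0 0 (block_mx N 1%:M (- 1%:M) 0)) =
  block_mx (invmx P) 0 0 (block_mx 0 (- 1%:M) 1%:M N).
Proof.
move=> uP; set M := block_mx P _ _ _; set Z := block_mx (invmx P) _ _ _.
have MZ : M *m Z = 1%:M.
  rewrite /M /Z !mulmx_block !mulmx0 !mul0mx !addr0 !add0r mulmxV //.
  rewrite !(mulmxN, mulNmx) !(mulmx1, mul1mx) !opprK addNr.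
  by rewrite -!scalar_mx_block.
have [uM _] := mulmx1_unit MZ; split=> //.
by rewrite -[RHS](mulKmx uM) MZ mulmx1.
Qed.

Variables (C : numClosedFieldType) (n m : nat) (S : system C n m) (M1 : 'M[C]_m).

Lemma extended_regular (l : C) : l *: sysE S - sysA S \in unitmx ->
  l *: sysE (extended_system S M1) - sysA (extended_system S M1) \in unitmx.
Proof.
move=> u /=; have [h _] := augmented_inv (l *: M1) u.
suff -> : l *: block_mx (sysE S) 0 0 (block_mx M1 0 0 0) -
    block_mx (sysA S) 0 0 (block_mx 0 (- 1%:M) 1%:M 0) =
  block_mx (l *: sysE S - sysA S) 0 0 (block_mx (l *: M1) 1%:M (- 1%:M) 0).
  exact: h.
rewrite !scale_block_mx !scaler0 !opp_block_mx !add_block_mx.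
by rewrite !oppr0 !addr0 opprK !sub0r add0r.
Qed.

Lemma extended_transfer : ratpencil (sysE S) (sysA S) \in unitmx ->
  transfer (extended_system S M1) =
  ratX C *: map_mx (@ratC C) M1 + transfer S.
Proof.
move=> uP; rewrite /transfer [RHS]addrA; congr (_ + _).
have -> : ratX C *: map_mx (@ratC C) (sysE (extended_system S M1)) -
    map_mx (@ratC C) (sysA (extended_system S M1)) =
    block_mx (ratpencil (sysE S) (sysA S)) 0 0
      (block_mx (ratX C *: map_mx (@ratC C) M1) 1%:M (- 1%:M) 0).
  rewrite /= !map_block_mx !map_mxN !map_mx0 !map_mx1 !scale_block_mx !scaler0.
  rewrite !opp_block_mx !add_block_mx.
  by rewrite !oppr0 !addr0 opprK !sub0r add0r.
have [_ ->] := augmented_inv (ratX C *: map_mx (@ratC C) M1) uP.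
rewrite /= !map_row_mx !map_col_mx !map_mx0 !map_mx1.
rewrite !mul_row_block !mul_row_col !mulmx0 !mul0mx !add0r !addr0.
by rewrite !mul1mx mul_row_col mulmx0 add0r mulmx1 addrC.
Qed.

End Augmentation.

(** On the appended states [A'] is skew-Hermitian and [Q'] is the identity, so they contribute
    nothing to [A'^H Q' + Q'^H A']; their input and output blocks cancel as well. What remains is
    the old matrix pulled back along [T], which forgets these states. *)
Lemma augmented_lmi_psd (C : numClosedFieldType) n m (A Q : 'M[C]_n) B L
    (H : 'M[C]_m) :
  psdmx (block_mx (- (A^t* *m Q + Q^t* *m A)) (L^t* - Q^t* *m B)
                  (L - B^t* *m Q) H) ->
  let A' := block_mx A 0 0 (block_mx 0 (- 1%:M) 1%:M (0 : 'M_m)) in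
  let Q' := block_mx Q 0 0 1%:M in
  let B' := col_mx B (col_mx 0 1%:M) in
  let L' := row_mx L (row_mx 0 1%:M) in
  psdmx (block_mx (- (A'^t* *m Q' + Q'^t* *m A')) (L'^t* - Q'^t* *m B')
                  (L' - B'^t* *m Q') H).
Proof.
move=> pW A' Q' B' L'.
pose T := block_mx (row_mx (1%:M : 'M[C]_n) (0 : 'M_(n, m + m))) (0 : 'M_(n, m))
  (0 : 'M_(m, n + (m + m))) 1%:M.
suff -> : block_mx (- (A'^t* *m Q' + Q'^t* *m A')) (L'^t* - Q'^t* *m B')
    (L' - B'^t* *m Q') H =
  T^t* *m block_mx (- (A^t* *m Q + Q^t* *m A)) (L^t* - Q^t* *m B)
                  (L - B^t* *m Q) H *m T by exact: psd_congr.
rewrite /A' /Q' /B' /L' /T !trmxC_block !trmxC0 !trmxC1 !trmxCN !trmxC1.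
rewrite !tr_row_mx !tr_col_mx !map_row_mx !map_col_mx !trmxC1 !trmxC0.
rewrite !mulmx_block !mulmx0 !mul0mx !addr0 !add0r !mulmx1 !mul1mx.
congr block_mx.
- rewrite !add_block_mx !opp_block_mx subrr addNr !addr0 !oppr0.
  by rewrite mul_col_mx mul1mx mul0mx mul_col_mx mul_mx_row mulmx1 mulmx0 mul0mx
    /block_mx !row_mx0 !col_mx0 !row_mx0.
- rewrite mul_block_col !mul0mx addr0 add0r mul1mx opp_col_mx add_col_mx subrr.
  by rewrite mul_col_mx mul1mx mul0mx.
- rewrite mul_row_block !mulmx0 addr0 add0r mulmx1 opp_row_mx add_row_mx subrr.
  by rewrite mul_mx_row mulmx1 mulmx0.
Qed.

Lemma extended_port_Hamiltonian (R : realType) (K : base_field) n m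
    (E A Q : 'M[R[i]]_n) B L (D M1 : 'M[R[i]]_m) :
  mx_over K A -> mx_over K B -> mx_over K L -> mx_over K D -> mx_over K Q ->
  Q \in unitmx -> psdmx (Q^t* *m E) -> psdmx M1 ->
  psdmx (block_mx (- (A^t* *m Q + Q^t* *m A)) (L^t* - Q^t* *m B)
                  (L - B^t* *m Q) (D + D^t*)) ->
  port_Hamiltonian K (extended_system (System E A B L D) M1)
    (block_mx Q 0 0 1%:M).
Proof.
move=> oA oB oL oD oQ uQ pE pM1 pW.
have o0 p q := mx_over0 R K p q; have o1 p := mx_over1 R K p.
apply: port_Hamiltonian_of_lmi.
- exact: mx_over_block oA (o0 _ _) (o0 _ _)
    (mx_over_block (o0 _ _) (mx_overN (o1 _)) (o1 _) (o0 _ _)).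
- exact: mx_over_col oB (mx_over_col (o0 _ _) (o1 _)).
- exact: mx_over_row oL (mx_over_row (o0 _ _) (o1 _)).
- exact: oD.
- exact: mx_over_block oQ (o0 _ _) (o0 _ _) (o1 _).
- by rewrite unitmxE det_ublock det1 mulr1 -unitmxE.
- rewrite trmxC_block !trmxC0 trmxC1 mulmx_block !mulmx0 !mul0mx !addr0 !add0r.
  rewrite mul1mx; apply: psd_block_diag pE _; apply: psd_block_diag pM1 _.
  split=> [|x]; first by rewrite trmxC0.
  by rewrite mulmx0 mul0mx mxE.
exact: augmented_lmi_psd.
Qed.

(** * Frequency conditions from positive realness, and the conclusion *)

Lemma Re_gt0 (C : numClosedFieldType) (s : C) : (0 < 'Re s) = (0 < s + s^*).
Proof. by rewrite ReE pmulr_lgt0 // invr_gt0 ltr0n. Qed.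

(* Evaluate at [s = e + i t] with [t] large: there the inequality holds for the
   value [V] of [T], which is arbitrarily close to [L]. *)
Lemma psd_at_infinity (C : numClosedFieldType) m (T : 'M[ratfun C]_m)
    (L M1 : 'M[C]_m) :
  M1 = M1^t* -> lim_infty T L ->
  (forall s V, 0 < s + s^* -> has_mxvalue T s V ->
     psdmx (V + V^t* + (s + s^*) *: M1)) ->
  forall e, 0 < e -> psdmx (L + L^t* + (e + e) *: M1).
Proof.
move=> hM hlim hpsd e e0.
have eC : e^* = e by rewrite geC0_conj // ltW.
set N := L + L^t* + (e + e) *: M1.
have hN : N = N^t*.
  by rewrite /N !trmxCD trmxCK trmxCZ rmorphD /= eC -hM [L^t* + L]addrC.
have NE : N = L + L^t* + (e + e) *: M1 by [].
clearbody N.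
split=> // x; set q := (_ *m _) 0 0.
have qr : q \is Num.real.
  apply/CrealP; rewrite /q -trace_mx11 -mxtrace_conj !trmxCM trmxCK -hN.
  by rewrite mulmxA.
rewrite real_leNgt ?real0 //; apply/negP => q0.
pose c := \sum_i \sum_j `|x j 0| * `|x i 0|.
have c0 : 0 <= c by do 2![apply: sumr_ge0 => ? _]; rewrite mulr_ge0.
(* The error in the form is at most [2 d c = - q c / (1 + c)], which is less than [- q]; the summand
   1 keeps the denominator nonzero when [c = 0]. *)
pose d := - q / ((1 + c) + (1 + c)).
have c1 : 0 < 1 + c by rewrite ltr_pwDl.
have d0 : 0 < d by rewrite divr_gt0 ?oppr_gt0 // addr_gt0.
have [r r0 hr] := hlim d d0.
pose t := r + 1; have t0 : 0 < t by rewrite addr_gt0.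
pose s := e + 'i * t.
have sE : s + s^* = e + e.
  rewrite /s rmorphD rmorphM /= eC conjCi (geC0_conj (ltW t0)) mulNr.
  by rewrite addrACA subrr addr0.
have rs : r < `|s|.
  rewrite -(@ltr_pXn2r _ 2) ?nnegrE ?(ltW r0) // /s normC2_rect ?gtr0_real //.
  rewrite ltr_wpDl ?exprn_ge0 ?(ltW e0) // ltr_pXn2r ?nnegrE ?(ltW r0) ?(ltW t0) //.
  by rewrite /t ltrDl.
have [V hV hVL] := hr s rs.
have s0 : 0 < s + s^* by rewrite sE addr_gt0.
have [_ /(_ x)] := hpsd s V s0 hV; rewrite sE.
have -> : V + V^t* + (e + e) *: M1 = N + ((V - L) + (V - L)^t*).
  rewrite NE trmxCD trmxCN; move: (_ *: M1) (V^t*) (L^t*) => a b l.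
  by apply/matrixP => i j; rewrite !mxE; ring.
rewrite mulmxDr mulmxDl mxE -/q.
set q' := (_ *m _) 0 0 => hq.
have : `|q'| <= (d + d) * c.
  apply: qf_bound => i j; rewrite mxE; apply: le_trans (ler_normD _ _) _.
  have h k l : `|(V - L) k l| <= d by rewrite !mxE; exact/ltW/hVL.
  by rewrite lerD //; have := h j i; rewrite !mxE /= norm_conjC.
have q'r : q' \is Num.real.
  have : q + q' \is Num.real by rewrite ger0_real.
  by move=> h; rewrite -[q'](addKr q) realD // realN.
move=> hq'; have : q + (d + d) * c < 0.
  have -> : q + (d + d) * c = q / (1 + c).
    by rewrite /d; field; rewrite !gt_eqF // addr_gt0.
  by rewrite pmulr_llt0 ?invr_gt0.
rewrite le_gtF //; apply: le_trans hq _; rewrite lerD2l.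
by apply: le_trans hq'; exact: real_ler_norm.
Qed.

(** Comparing values at a positive integer [k] where both pencils are invertible gives
    [M1 = (V - V') / k], and every operation involved stays in the base field. *)
Lemma polynomial_part_base (R : realType) (K : base_field) n n' m
    (S : system R[i] n m) (S' : system R[i] n' m) (M1 : 'M[R[i]]_m) :
  descriptor_system K S -> descriptor_system K S' ->
  transfer S = ratX R[i] *: map_mx (@ratC R[i]) M1 + transfer S' ->
  mx_over K M1.
Proof.
move=> [[oE oA oB oL oD] reg] [[oE' oA' oB' oL' oD'] reg'] h.
have [k [k0 u u']] := pencil_unit_nat reg reg'.
have h1 := has_mxvalue_transfer u; have h2 := has_mxvalue_transfer u'.
have h3 := has_mxvalueD (has_mxvalueZ (has_value_ratX k%:R)
  (has_mxvalue_ratC M1 k%:R)) h2.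
rewrite -h in h3; have {h1 h3} := has_mxvalue_uniq h1 h3.
set V := (X in X = _); set V' := (X in _ = _ + X) => VE.
have oP (j : nat) (E A : 'M[R[i]]_j) : mx_over K E -> mx_over K A ->
    mx_over K (invmx (k%:R *: E - A)).
  move=> hE hA.
  exact: mx_over_inv (mx_overD (mx_over_nat_scale _ hE) (mx_overN hA)).
have oV : mx_over K V.
  exact: mx_overD (mx_overM (mx_overM oL (oP _ _ _ oE oA)) oB) oD.
have oV' : mx_over K V'.
  exact: mx_overD (mx_overM (mx_overM oL' (oP _ _ _ oE' oA')) oB') oD'.
have -> : M1 = k%:R^-1 *: (V - V').
  by rewrite VE addrK scalerA mulVf ?scale1r // pnatr_eq0 -lt0n.
exact: mx_over_natV_scale (mx_overD oV (mx_overN oV')).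
Qed.

Theorem mainTheorem6 (R : realType) (K : base_field) (n m : nat)
  (Sigma : system R[i] n m)
  (hSigma : descriptor_system K Sigma)
  (hctrl : behaviorally_controllable Sigma)
  (hobs : behaviorally_observable Sigma)
  (hpr : positive_real (transfer Sigma))
  (M1 : 'M[R[i]]_m) (Tp : 'M[ratfun R[i]]_m)
  (hM1 : M1 = M1 ^t* /\ psdmx M1)
  (hTp : proper_ratmx Tp)
  (hdec : transfer Sigma = ratX R[i] *: map_mx (@ratC R[i]) M1 + Tp)
  (M0 : 'M[R[i]]_m)
  (hM0 : lim_infty Tp M0)
  (np : nat) (Ep Ap : 'M[R[i]]_np) (Bp : 'M[R[i]]_(np, m))
  (Cp : 'M[R[i]]_(m, np))
  (hmin : minimal_realization K (System Ep Ap Bp Cp M0) Tp)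
  (hEp : Ep \in unitmx) :
  exists Qp : 'M[R[i]]_np,
    [/\ Qp \in unitmx,
        psdmx (Qp ^t* *m Ep),
        port_Hamiltonian K (System Ep Ap Bp Cp M0) Qp,
        realization K (extended_system (System Ep Ap Bp Cp M0) M1)
          (transfer Sigma) &
        port_Hamiltonian K (extended_system (System Ep Ap Bp Cp M0) M1)
          (block_mx Qp 0 0 1%:M)].
Proof.
have [M1H pM1] := hM1.
have [[dS trS] _] := hmin; have [[/= oE oA oB oL oD] reg] := dS.
pose A := invmx Ep *m Ap; pose B := invmx Ep *m Bp.
have obs : kalman_observable A Cp := minimal_observable hmin hEp.
have ctr : kalman_controllable A B := minimal_controllable hmin hEp.
have trN : transfer (System 1%:M A B Cp M0) = Tp.
  by rewrite -trS [RHS]transfer_normalize.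
have oM1 : mx_over K M1.
  by apply: (polynomial_part_base hSigma dS); rewrite trS.
have freq0 s V : 0 < s + s^* -> has_mxvalue Tp s V ->
    psdmx (V + V^t* + (s + s^*) *: M1).
  move=> s0 hV; have [_ hp] := hpr.
  have := hp s (s *: M1 + V); rewrite Re_gt0 hdec => /(_ s0).
  have -> : s *: M1 + V + (s *: M1 + V)^t* = V + V^t* + (s + s^*) *: M1.
    by rewrite trmxCD trmxCZ -M1H addrACA -scalerDl addrC.
  apply; apply: has_mxvalueD hV.
  exact: has_mxvalueZ (has_value_ratX s) (has_mxvalue_ratC M1 s).
(* [T_p = T - s M1] has no pole in the open right half-plane because [T] has none, and by minimality
   the same holds for the resolvent of [A]. *)
have stab s : 0 < s + s^* -> s *: 1%:M - A \in unitmx.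
  move=> s0; apply: (regular_resolvent (D := M0) obs ctr); rewrite trN => i j.
  have [hn _] := hpr; have /contrapT[v hv] : ~ pole (transfer Sigma i j) s.
    by apply: hn; rewrite Re_gt0.
  have hX := has_mxvalueN (has_mxvalueZ (has_value_ratX s) (has_mxvalue_ratC M1 s)).
  have := has_valueD (hX i j) hv.
  have := congr1 (fun M : 'M_m => M i j) hdec; rewrite [in RHS]mxE => ->.
  rewrite [X in X + (_ + _)]mxE addKr => h; eexists; exact: h.
have freq s : 0 < s + s^* ->
    let T := Cp *m invmx (s *: 1%:M - A) *m B + M0 in
    psdmx (T + T^t* + (s + s^*) *: M1).
  move=> s0 T; have us := stab _ s0; apply: freq0 s0 _; rewrite -trN.
  exact: (has_mxvalue_transfer (S := System 1%:M A B Cp M0) us).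
have freqi := psd_at_infinity M1H hM0 freq0.
have [X [pX pK]] : exists X, psdmx X /\ psdmx (kyp_mx A B Cp (M0 + M0^t*) X).
  (* Without inputs there is no state with [ell = 0] to feed to [separation]; in that case
     controllability leaves only the empty state space. *)
  have [m0|m0] := posnP m; last first.
    have [X pX pK] := kyp_lemma (@complex_bounded_ultra_cvg R) (@complex_inf R)
      stab freq freqi m0 ctr.
    by exists X.
  have n0 : np = 0%N.
    apply/eqP/negPn/negP; rewrite -lt0n => n0.
    have /matrixP/(_ 0 (Ordinal n0))/eqP : delta_mx 0 (Ordinal n0) = 0 :> 'rV[R[i]]_np.
      apply: ctr => j; apply/matrixP => i k; exfalso.
      by have := ltn_ord k; rewrite [X in (_ < X)%N]m0.
    by rewrite !mxE !eqxx oner_eq0.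
  by exists 0; split; apply: psd_flat; rewrite ?n0 ?m0.
have oAn : mx_over K A := mx_overM (mx_over_inv oE) oA.
have oBn : mx_over K B := mx_overM (mx_over_inv oE) oB.
have {X pX pK} [X [oX pX pK]] :=
  kyp_base oAn oBn oL (mx_overD oD (mx_over_adj oD)) pX pK.
have uX := kyp_unit obs pX pK; have [hX _] := pX.
(* Chosen so that [Q^H Ep = X] and [Q^H Ap = X A]: the inequality for [A] and [B] is then literally
   the one for [Ap] and [Bp]. *)
pose Q := (invmx Ep)^t* *m X.
have QE p (Z : 'M_(np, p)) : Q^t* *m Z = X *m (invmx Ep *m Z).
  by rewrite /Q trmxCM trmxCK -hX mulmxA.
have pE : psdmx (Q^t* *m Ep) by rewrite QE (mulVmx hEp) mulmx1.
have uQ : Q \in unitmx.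
  by rewrite unitmx_mul uX map_unitmx unitmx_tr unitmx_inv hEp.
have oQ : mx_over K Q := mx_overM (mx_over_adj (mx_over_inv oE)) oX.
have lmi : psdmx (block_mx (- (Ap^t* *m Q + Q^t* *m Ap)) (Cp^t* - Q^t* *m Bp)
    (Cp - Bp^t* *m Q) (M0 + M0^t*)).
  have EQ p (Z : 'M_(np, p)) : Z^t* *m Q = (invmx Ep *m Z)^t* *m X.
    by rewrite /Q mulmxA -trmxCM.
  by rewrite !EQ !QE; exact: pK.
exists Q; split.
- exact: uQ.
- exact: pE.
- exact: (port_Hamiltonian_of_lmi oA oB oL oD oQ uQ pE lmi).
- have o0 p q := mx_over0 R K p q; have o1 p := mx_over1 R K p.
  split; last first.
    have [l hl] := reg.
    pose Sp := System Ep Ap Bp Cp M0.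
    have u : ratpencil (sysE Sp) (sysA Sp) \in unitmx := ratpencil_unit hl.
    by rewrite (extended_transfer M1 u) trS -hdec.
  split; last by have [l hl] := reg; exists l; exact: extended_regular.
  split.
  + exact: mx_over_block oE (o0 _ _) (o0 _ _)
      (mx_over_block oM1 (o0 _ _) (o0 _ _) (o0 _ _)).
  + exact: mx_over_block oA (o0 _ _) (o0 _ _)
      (mx_over_block (o0 _ _) (mx_overN (o1 _)) (o1 _) (o0 _ _)).
  + exact: mx_over_col oB (mx_over_col (o0 _ _) (o1 _)).
  + exact: mx_over_row oL (mx_over_row (o0 _ _) (o1 _)).
  + exact: oD.
- exact: (extended_port_Hamiltonian oA oB oL oD oQ uQ pE pM1 lmi).
Qed.
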